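(* In the space of constant positive curvature $S^3$, the homogeneous liquid self-gravitating spheroid (constant density $\rho_0$ in the region $\mu\le\mu_0$, in a steady axisymmetric flow $\dot r=0$, $\dot\mu=0$, $\dot\varphi=\omega$, with zero pressure on the free boundary $\mu=\mu_0$) cannot rotate as a rigid body, and the angular velocity distribution of fluid particles depends only on the distance to the symmetry axis: $\omega=\omega(r)$.
   Context: Space and coordinates. $S^3=\{x_0^2+x_1^2+x_2^2+x_3^2=R^2\}\subset\mathbb R^4$ carries the induced metric. Coordinates $(r,\mu,\varphi)$ are given by $x_0=\sqrt{R^2-r^2-Z^2(r,\mu)}$, $x_1=Z(r,\mu)$, $x_2=r\cos\varphi$, $x_3=r\sin\varphi$. Here $r$ measures the distance to the symmetry axis $r=0$. The surfaces $\mu=\mathrm{const}$ are the confocal spheroids $$\frac{x_0^2}{R^2-d^2\mu^2}-\frac{x_1^2}{d^2\mu^2}-\frac{x_2^2+x_3^2}{d^2(1+\mu^2)}=0,\qquad \mu\in\Big[0,\frac Rd\Big],$$ that is, $Z(r,\mu)=\pm\sqrt{d^2\mu^2-r^2\frac{R^2+d^2}{R^2}\frac{\mu^2}{1+\mu^2}}$. Body. The liquid spheroid has semi-axes $a>b>0$, with $d=\sqrt{a^2-b^2}$ and boundary $\mu=\mu_0=b/\sqrt{a^2-b^2}$. The density is $\rho=\rho_0=\mathrm{const}>0$ for $\mu\le\mu_0$ and $\rho=0$ for $\mu>\mu_0$. Equations of the steady flow. The velocity field is $\dot r=0$, $\dot\mu=0$, $\dot\varphi=\omega(r,\mu)$.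 The pressure $p$ and the gravitational potential $U$ depend only on $(r,\mu)$, and inside the body $$\frac{\partial U}{\partial r}+\frac1\rho\frac{\partial p}{\partial r}=r\omega^2,\qquad \frac{\partial U}{\partial\mu}+\frac1\rho\frac{\partial p}{\partial\mu}=0,\qquad p|_{\mu=\mu_0}=0.$$ The potential satisfies $\Delta U=4\pi G\rho$, where $\Delta$ is the Laplace–Beltrami operator of $S^3$ and $G$ is the gravitational constant. Rigid-body rotation means that $\omega$ has the same value for all fluid particles. Potential. The curvature is assumed very small ($R^2\gg a^2$). $U$ is sought as a power series in $d^2/R^2$, $$U(r,\mu)=2\pi Gd^2\sum_{n\ge0}\Big(\frac dR\Big)^{2n}U_n(r,\mu),\qquad U_n(r,\mu)=\sum_m\Big(\frac rd\Big)^{2m}\frac{u_{n,m}(\mu)}{2^m(1+\mu^2)^m},$$ each $U_n$ being a polynomial in $r$, and only the first correction $U_1$ (with $m=0,1,2$) is calculated. $U_0$ is, up to a multiplier, the Euclidean potential of the homogeneous (Maclaurin) spheroid: it has only the terms $m=0,1$, with, for $\mu\le\mu_0$, $$u_{0,0}=\rho_0(1+\mu_0^2)\big(\mu^2-\mu_0(1+\mu^2)\operatorname{arccot}\mu_0\big),\quad u_{0,1}=\rho_0\big(\mu_0(1+3\mu^2)((1+\mu_0^2)\operatorname{arccot}\mu_0-\mu_0)-2\mu^2\big),$$ and, for $\mu>\mu_0$, $$u_{0,0}=\rho_0\mu_0(1+\mu_0^2)\big(\mu-(1+\mu^2)\operatorname{arccot}\mu\big),\quad u_{0,1}=\rho_0\mu_0(1+\mu_0^2)\big((1+3\mu^2)\operatorname{arccot}\mu-3\mu\big).$$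 The functions $u_{1,m}$ satisfy $u_{1,m}'(0)=0$, are continuous together with their first derivatives across $\mu=\mu_0$, and are such that $U_1(r,\mu)|_{\mu=R/d}=O(R^2)$. *)

(* Defs.v *)
From Stdlib Require Import Reals Lra Lia.
From Coquelicot Require Import Coquelicot.
Open Scope R_scope.

(* [Rc] is the radius of the three-sphere and [d] the focal parameter
   throughout; the symbol [R] is the type of real numbers. *)

Definition arccot (x : R) : R := PI / 2 - atan x.

(* The half x_1 >= 0.  All fields below depend on (r, mu) only, and the other
   sign of Z is obtained by the isometry x_1 |-> - x_1, which leaves the metric
   coefficients unchanged. *)
Definition Zcoord (d Rc r mu : R) : R :=
  sqrt (d ^ 2 * mu ^ 2
        - r ^ 2 * ((Rc ^ 2 + d ^ 2) / Rc ^ 2) * (mu ^ 2 / (1 + mu ^ 2))).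

(* Cartesian coordinates x_0, ..., x_3 of the point (r, mu, phi). *)
Definition embed (d Rc : R) (k : nat) (r mu phi : R) : R :=
  match k with
  | 0%nat => sqrt (Rc ^ 2 - r ^ 2 - Zcoord d Rc r mu ^ 2)
  | 1%nat => Zcoord d Rc r mu
  | 2%nat => r * cos phi
  | _ => r * sin phi
  end.

(* Regular points of the coordinate system: r > 0, x_0 > 0 and Z > 0.  The last
   inequality says that the radicand of [Zcoord] is positive; together with
   mu < Rc / d it implies that the radicand of x_0 is positive as well. *)
Definition chart (d Rc r mu : R) : Prop :=
  0 < r /\ 0 < mu < Rc / d /\
  r ^ 2 * ((Rc ^ 2 + d ^ 2) / Rc ^ 2) < d ^ 2 * (1 + mu ^ 2).

(* The closed body mu <= mu0 without the axis r = 0, whose particles have no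
   angular velocity.  Unlike in [chart], the focal disc mu = 0 and the
   equatorial plane Z = 0 are included. *)
Definition body (d mu0 Rc r mu : R) : Prop :=
  0 < r /\ 0 <= mu <= mu0 /\
  r ^ 2 * ((Rc ^ 2 + d ^ 2) / Rc ^ 2) <= d ^ 2 * (1 + mu ^ 2).

Inductive coord : Set := Cr | Cmu | Cphi.

(* Cyclic successor; with it the cofactors of a 3 x 3 matrix need no sign. *)
Definition nxt (i : coord) : coord :=
  match i with Cr => Cmu | Cmu => Cphi | Cphi => Cr end.

Definition sum3 (F : coord -> R) : R := F Cr + F Cmu + F Cphi.

Definition cofactor3 (A : coord -> coord -> R) (i j : coord) : R :=
  A (nxt i) (nxt j) * A (nxt (nxt i)) (nxt (nxt j))
  - A (nxt i) (nxt (nxt j)) * A (nxt (nxt i)) (nxt j).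

Definition det3 (A : coord -> coord -> R) : R :=
  sum3 (fun j => A Cr j * cofactor3 A Cr j).

Definition inv3 (A : coord -> coord -> R) (i j : coord) : R :=
  cofactor3 A j i / det3 A.

Definition pd (i : coord) (f : R -> R -> R -> R) (r mu phi : R) : R :=
  match i with
  | Cr => Derive (fun t => f t mu phi) r
  | Cmu => Derive (fun t => f r t phi) mu
  | Cphi => Derive (fun t => f r mu t) phi
  end.

(* Metric induced on the sphere by the Euclidean metric of R^4. *)
Definition metric (d Rc r mu phi : R) (i j : coord) : R :=
  sum_f_R0 (fun k => pd i (embed d Rc k) r mu phi * pd j (embed d Rc k) r mu phi) 3.

(* Laplace-Beltrami operator
   |g|^(-1/2) sum_(i, j) d_i (|g|^(1/2) g^(i j) d_j f). *)
Definition laplace_beltrami (d Rc : R) (f : R -> R -> R -> R) (r mu phi : R) : R :=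
  / sqrt (det3 (metric d Rc r mu phi)) *
  sum3 (fun i => sum3 (fun j =>
    pd i (fun r' mu' phi' =>
      sqrt (det3 (metric d Rc r' mu' phi'))
      * inv3 (metric d Rc r' mu' phi') i j
      * pd j f r' mu' phi') r mu phi)).

Definition density (rho0 mu0 mu : R) : R :=
  if Rle_dec mu mu0 then rho0 else 0.

Definition poisson (d mu0 G rho0 Rc : R) (U : R -> R -> R) : Prop :=
  forall r mu phi, chart d Rc r mu -> mu <> mu0 ->
    ex_diff_n U 2 r mu /\
    laplace_beltrami d Rc (fun r' mu' _ => U r' mu') r mu phi
    = 4 * PI * G * density rho0 mu0 mu.

Definition continuous_on_body (d mu0 Rc : R) (f : R -> R -> R) : Prop :=
  continuous_on (fun q : R * R => body d mu0 Rc (fst q) (snd q))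
                (fun q : R * R => f (fst q) (snd q)).

(* Steady flow r' = 0, mu' = 0, phi' = omega (r, mu). *)
Record steady_flow (d mu0 rho0 Rc : R) (U p omega : R -> R -> R) : Prop := {
  flow_cont_U : continuous_on_body d mu0 Rc U;
  flow_cont_p : continuous_on_body d mu0 Rc p;
  flow_cont_omega : continuous_on_body d mu0 Rc omega;
  flow_diff_p : forall r mu, chart d Rc r mu -> mu < mu0 ->
    ex_derive (fun t => p t mu) r /\ ex_derive (fun t => p r t) mu;
  flow_r : forall r mu, chart d Rc r mu -> mu < mu0 ->
    Derive (fun t => U t mu) r + / rho0 * Derive (fun t => p t mu) r
    = r * omega r mu ^ 2;
  flow_mu : forall r mu, chart d Rc r mu -> mu < mu0 ->
    Derive (fun t => U r t) mu + / rho0 * Derive (fun t => p r t) mu = 0;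
  flow_free_boundary : forall r, body d mu0 Rc r mu0 -> p r mu0 = 0
}.

(* U_n (r, mu) = sum_(m <= M) (r/d)^(2m) v_m(mu) / (2^m (1 + mu^2)^m). *)
Definition Ucoef (d : R) (v : nat -> R -> R) (M : nat) (r mu : R) : R :=
  sum_f_R0 (fun m => (r / d) ^ (2 * m) * (v m mu / (2 ^ m * (1 + mu ^ 2) ^ m))) M.

Definition u00 (rho0 mu0 mu : R) : R :=
  if Rle_dec mu mu0
  then rho0 * (1 + mu0 ^ 2) * (mu ^ 2 - mu0 * (1 + mu ^ 2) * arccot mu0)
  else rho0 * mu0 * (1 + mu0 ^ 2) * (mu - (1 + mu ^ 2) * arccot mu).

Definition u01 (rho0 mu0 mu : R) : R :=
  if Rle_dec mu mu0
  then rho0 * (mu0 * (1 + 3 * mu ^ 2) * ((1 + mu0 ^ 2) * arccot mu0 - mu0)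
               - 2 * mu ^ 2)
  else rho0 * mu0 * (1 + mu0 ^ 2) * ((1 + 3 * mu ^ 2) * arccot mu - 3 * mu).

(* The coefficients u_(n, m), 0 <= m <= M n, do not depend on Rc. *)
Record coefficients (d mu0 rho0 : R) (u : nat -> nat -> R -> R) (M : nat -> nat) : Prop := {
  coef_deg0 : M 0%nat = 1%nat;
  coef_deg1 : M 1%nat = 2%nat;
  coef_smooth : forall n m k mu, (m <= M n)%nat -> (k <= 2)%nat ->
    0 < mu -> mu <> mu0 -> ex_derive_n (u n m) k mu;
  coef_u00 : forall mu, 0 <= mu -> u 0%nat 0%nat mu = u00 rho0 mu0 mu;
  coef_u01 : forall mu, 0 <= mu -> u 0%nat 1%nat mu = u01 rho0 mu0 mu;
  (* u_(1, m)'(0) = 0; mu ranges over [0, Rc / d], so this is a one-sided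
     derivative. *)
  coef_at0 : forall m, (m <= 2)%nat ->
    filterlim (fun h => (u 1%nat m h - u 1%nat m 0) / h) (at_right 0) (locally 0);
  coef_C1 : forall m, (m <= 2)%nat ->
    ex_derive (u 1%nat m) mu0 /\ continuous (Derive (u 1%nat m)) mu0;
  (* U_1 = O (Rc^2) on the great sphere mu = Rc / d, which is x_0 = 0 and is
     swept by 0 <= r <= Rc. *)
  coef_growth : exists C R1, forall Rc r, R1 <= Rc -> 0 <= r <= Rc ->
    Rabs (Ucoef d (u 1%nat) 2 r (Rc / d)) <= C * Rc ^ 2
}.

(* U = 2 pi G d^2 sum_n (d/Rc)^(2n) U_n as a power series in (d/Rc)^2, convergent
   at each point for large Rc, and differentiated term by term up to order 2
   off mu = mu0 (second derivatives in mu jump at mu0).  As Rc tends to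
   infinity the charts exhaust r^2 < d^2 (1 + mu^2). *)
Definition power_series_potential (d mu0 G : R) (u : nat -> nat -> R -> R)
    (M : nat -> nat) (U : R -> R -> R -> R) : Prop :=
  forall r mu, 0 < r -> 0 < mu -> r ^ 2 < d ^ 2 * (1 + mu ^ 2) ->
  exists R1, forall Rc, R1 < Rc ->
  forall j k : nat, (j + k = 0)%nat \/ ((j + k <= 2)%nat /\ mu <> mu0) ->
    is_pseries
      (fun n => 2 * PI * G * d ^ 2 * partial_derive j k (Ucoef d (u n) (M n)) r mu)
      ((d / Rc) ^ 2)
      (partial_derive j k (U Rc) r mu).

(* Main.v *)
Require Import Defs.
From Stdlib Require Import Reals Lra Lia.
From Coquelicot Require Import Coquelicot.
Open Scope R_scope.

(** By the second Euler equation U + p / rho does not depend on mu; hence, by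
    the first one, neither does omega^2, and continuity gives omega = omega (r).
    If omega were a constant c, then U - c^2 r^2 / 2 would be constant on the free
    boundary, where p = 0.  But U_0 is quadratic in r there, whereas the
    r^4-coefficient of U_1 is a positive multiple of u_(1,2) (mu0).  Indeed the
    r^4-terms of first order in (d/Rc)^2 in the Poisson equation give
    ((1 + mu^2) u')' - 20 u = - 16 u_(0,1) for u = u_(1,2), that is,
    u = 8/7 u_(0,1) plus, inside, - 8/35 rho0 + c P_4 (i mu) and, outside, a
    multiple of Q_4 (i mu).  Matching both at mu0 reduces u (mu0) > 0 to
    an elementary lower bound for arccot mu0. *)

(** * Laplace-Beltrami operator in the coordinates (r, mu, phi) *)

(** The series for U converges pointwise only, with a threshold for Rc depending on (r, mu), so
    nothing uniform in the point is available. First-order information is therefore extracted at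
    fixed points: with e = (d/Rc)^2 as the variable, an identity valid for small e > 0 is
    differentiated at e = 0. For this the Laplacian has to be explicit and, after multiplication by
    [lapD], polynomial in e. The order r^4 is chosen because its equation is closed: u_(1,0),
    u_(1,1) and the density do not enter it. Each region leaves one free constant: u'(0) = 0
    excludes Q_4 inside, and the growth bound on mu = Rc / d excludes P_4 outside. The claim omega =
    omega (r) is exact and holds for every Rc > R0; the exclusion of rigid rotation needs a large
    Rc, for which the first correction outweighs the later ones at the three radii where U is
    compared. *)

Lemma ex_derive_continuity_pt (f : R -> R) (x : R) :
  ex_derive f x -> continuity_pt f x.
Proof.
  intros H; apply continuity_pt_filterlim, (ex_derive_continuous f x H).
Qed.

Lemma locally_2d_pos (f : R -> R -> R) (x y : R) :
  continuity_2d_pt f x y -> 0 < f x y -> locally_2d (fun u v => 0 < f u v) x y.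
Proof.
  intros Hf Hp.
  destruct (Hf (mkposreal _ Hp)) as [e He].
  exists e; intros u v Hu Hv.
  specialize (He u v Hu Hv); simpl in He.
  apply Rabs_def2 in He; lra.
Qed.

Lemma continuity_2d_pt_fst (f : R -> R) (x y : R) :
  continuity_pt f x -> continuity_2d_pt (fun u _ => f u) x y.
Proof.
  intros Hf; apply (continuity_1d_2d_pt_comp f (fun u _ : R => u)); auto.
  apply continuity_2d_pt_id1.
Qed.

Lemma continuity_2d_pt_snd (f : R -> R) (x y : R) :
  continuity_pt f y -> continuity_2d_pt (fun _ v => f v) x y.
Proof.
  intros Hf; apply (continuity_1d_2d_pt_comp f (fun _ v : R => v)); auto.
  apply continuity_2d_pt_id2.
Qed.

(** Openness allows the explicit formulas for the metric, valid only in the chart, to be substituted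
    under [Derive]. *)
Lemma chart_locally (d Rc r mu : R) :
  chart d Rc r mu -> locally_2d (chart d Rc) r mu.
Proof.
  intros (H1 & (H2 & H3) & H4); unfold chart.
  assert (P1 : locally_2d (fun u _ => 0 < u) r mu)
    by (apply locally_2d_pos; auto using continuity_2d_pt_id1).
  assert (P2 : locally_2d (fun _ v => 0 < v) r mu)
    by (apply locally_2d_pos; auto using continuity_2d_pt_id2).
  assert (P3 : locally_2d (fun _ v => 0 < Rc / d - v) r mu).
  { apply locally_2d_pos; try lra.
    apply continuity_2d_pt_snd; apply ex_derive_continuity_pt; auto_derive; auto. }
  assert (P4 : locally_2d (fun u v =>
     0 < d ^ 2 * (1 + v ^ 2) - u ^ 2 * ((Rc ^ 2 + d ^ 2) / Rc ^ 2)) r mu).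
  { apply locally_2d_pos; try lra.
    apply (continuity_2d_pt_minus (fun _ v => d ^ 2 * (1 + v ^ 2))
             (fun u _ => u ^ 2 * ((Rc ^ 2 + d ^ 2) / Rc ^ 2))).
    - apply (continuity_2d_pt_snd (fun v => d ^ 2 * (1 + v ^ 2))).
      apply ex_derive_continuity_pt; auto_derive; auto.
    - apply (continuity_2d_pt_fst (fun u => u ^ 2 * ((Rc ^ 2 + d ^ 2) / Rc ^ 2))).
      apply ex_derive_continuity_pt; auto_derive; auto. }
  generalize (locally_2d_and _ _ _ _ P1 (locally_2d_and _ _ _ _ P2
    (locally_2d_and _ _ _ _ P3 P4))).
  apply locally_2d_impl, locally_2d_forall; intros; lra.
Qed.

(** * The coordinates Z and x_0 and their derivatives *)

Definition Zsq (d Rc r mu : R) : R :=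
  d ^ 2 * mu ^ 2 - r ^ 2 * ((Rc ^ 2 + d ^ 2) / Rc ^ 2) * (mu ^ 2 / (1 + mu ^ 2)).

(** x_0^2 with the inner square root eliminated; this elimination is legitimate where [Zsq] is
    nonnegative, in particular on the chart. *)
Definition Xsq (d Rc r mu : R) : R := Rc ^ 2 - r ^ 2 - Zsq d Rc r mu.

Definition Xcoord (d Rc r mu : R) : R :=
  sqrt (Rc ^ 2 - r ^ 2 - Zcoord d Rc r mu ^ 2).

Definition Zr (d Rc r mu : R) : R :=
  - (r * ((Rc ^ 2 + d ^ 2) / Rc ^ 2) * (mu ^ 2 / (1 + mu ^ 2))) / Zcoord d Rc r mu.

Definition Zmu (d Rc r mu : R) : R :=
  mu * (d ^ 2 - r ^ 2 * ((Rc ^ 2 + d ^ 2) / Rc ^ 2) / (1 + mu ^ 2) ^ 2)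
  / Zcoord d Rc r mu.

Lemma Zsq_pos (d Rc r mu : R) : chart d Rc r mu -> 0 < Zsq d Rc r mu.
Proof.
  intros (H1 & (H2 & H3) & H4); unfold Zsq.
  replace (_ - _) with (mu ^ 2 / (1 + mu ^ 2) *
    (d ^ 2 * (1 + mu ^ 2) - r ^ 2 * ((Rc ^ 2 + d ^ 2) / Rc ^ 2))).
  - apply Rmult_lt_0_compat; [|lra].
    apply Rdiv_lt_0_compat; [apply pow_lt; lra|nra].
  - set (q := (Rc ^ 2 + d ^ 2) / Rc ^ 2); field; nra.
Qed.

(** The chart condition reads r^2 + r^2 d^2 / Rc^2 < d^2 (1 + mu^2). It bounds each of the two
    positive summands: the second one gives the bound with Rc, the first one the bound with d. *)
Lemma chart_div_bound (d Rc r mu : R) :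
  0 < d -> 0 < Rc -> chart d Rc r mu ->
  d * mu < Rc /\ r ^ 2 < Rc ^ 2 * (1 + mu ^ 2) /\ r ^ 2 < d ^ 2 * (1 + mu ^ 2).
Proof.
  intros Hd HR (H1 & (H2 & H3) & H4).
  assert (E : r ^ 2 * ((Rc ^ 2 + d ^ 2) / Rc ^ 2)
              = r ^ 2 + r ^ 2 * d ^ 2 / Rc ^ 2) by (field; lra).
  assert (0 < Rc ^ 2) by (apply pow_lt; lra).
  assert (0 < r ^ 2) by (apply pow_lt; lra).
  assert (0 < d ^ 2) by (apply pow_lt; lra).
  rewrite E in H4.
  assert (K : 0 < r ^ 2 * d ^ 2 / Rc ^ 2)
    by (apply Rdiv_lt_0_compat; auto; apply Rmult_lt_0_compat; auto).
  split; [|split; [|lra]].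
  - apply Rmult_lt_compat_l with (r := d) in H3; auto.
    replace (d * (Rc / d)) with Rc in H3 by (field; lra); lra.
  - assert (K2 : r ^ 2 * d ^ 2 / Rc ^ 2 < d ^ 2 * (1 + mu ^ 2)) by lra.
    apply Rmult_lt_compat_r with (r := Rc ^ 2 / d ^ 2) in K2.
    + replace (r ^ 2 * d ^ 2 / Rc ^ 2 * (Rc ^ 2 / d ^ 2)) with (r ^ 2) in K2
        by (field; lra).
      replace (d ^ 2 * (1 + mu ^ 2) * (Rc ^ 2 / d ^ 2))
        with (Rc ^ 2 * (1 + mu ^ 2)) in K2 by (field; lra).
      lra.
    + apply Rdiv_lt_0_compat; auto.
Qed.

(** In spheroidal coordinates x_0^2 separates. The product form makes positivity evident and splits
    the denominators of the Laplacian into simple factors. *)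
Lemma Xsq_factor (d Rc r mu : R) : Rc <> 0 ->
  Xsq d Rc r mu = (Rc ^ 2 - d ^ 2 * mu ^ 2) * (1 - r ^ 2 / (Rc ^ 2 * (1 + mu ^ 2))).
Proof.
  intros; unfold Xsq, Zsq; field.
  split; [nra|auto].
Qed.

Lemma Xsq_pos (d Rc r mu : R) :
  0 < d -> 0 < Rc -> chart d Rc r mu -> 0 < Xsq d Rc r mu.
Proof.
  intros Hd HR Hc; pose proof (chart_div_bound _ _ _ _ Hd HR Hc) as (A & B & _).
  destruct Hc as (H1 & (H2 & H3) & H4).
  rewrite Xsq_factor by lra.
  assert (0 < Rc ^ 2) by (apply pow_lt; lra).
  assert (0 < d * mu) by (apply Rmult_lt_0_compat; lra).
  apply Rmult_lt_0_compat; [nra|].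
  apply Rlt_0_minus, Rlt_div_l; nra.
Qed.

Lemma Zcoord_pos (d Rc r mu : R) : chart d Rc r mu -> 0 < Zcoord d Rc r mu.
Proof. intros H; apply sqrt_lt_R0, Zsq_pos, H. Qed.

Lemma Zcoord_sq (d Rc r mu : R) :
  chart d Rc r mu -> Zcoord d Rc r mu ^ 2 = Zsq d Rc r mu.
Proof. intros H; apply pow2_sqrt, Rlt_le, Zsq_pos, H. Qed.

Lemma Xcoord_eq (d Rc r mu : R) :
  chart d Rc r mu -> Xcoord d Rc r mu = sqrt (Xsq d Rc r mu).
Proof. intros H; unfold Xcoord; rewrite Zcoord_sq; auto. Qed.

Lemma Xcoord_pos (d Rc r mu : R) :
  0 < d -> 0 < Rc -> chart d Rc r mu -> 0 < Xcoord d Rc r mu.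
Proof.
  intros Hd HR H; rewrite Xcoord_eq by auto; apply sqrt_lt_R0, Xsq_pos; auto.
Qed.

Lemma Xcoord_sq (d Rc r mu : R) :
  0 < d -> 0 < Rc -> chart d Rc r mu ->
  Xcoord d Rc r mu ^ 2 = Rc ^ 2 - r ^ 2 - Zcoord d Rc r mu ^ 2.
Proof.
  intros Hd HR H; rewrite Xcoord_eq by auto.
  rewrite pow2_sqrt, Zcoord_sq by (auto; apply Rlt_le, Xsq_pos; auto).
  reflexivity.
Qed.

Lemma Zmu_pos (d Rc r mu : R) :
  0 < d -> 0 < Rc -> chart d Rc r mu -> 0 < Zmu d Rc r mu.
Proof.
  intros Hd HR H; pose proof (Zcoord_pos _ _ _ _ H).
  destruct H as (H1 & (H2 & H3) & H4).
  apply Rdiv_lt_0_compat; auto; apply Rmult_lt_0_compat; [lra|].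
  apply Rlt_0_minus, Rlt_div_l; [nra|].
  assert (0 < d ^ 2) by (apply pow_lt; lra); nra.
Qed.

Lemma Zcoord_diff_r (d Rc r mu : R) : chart d Rc r mu ->
  is_derive (fun t => Zcoord d Rc t mu) r (Zr d Rc r mu).
Proof.
  intros H; pose proof (Zsq_pos _ _ _ _ H); pose proof (Zcoord_pos _ _ _ _ H).
  replace (Zr d Rc r mu) with
    (- (2 * r * ((Rc ^ 2 + d ^ 2) / Rc ^ 2) * (mu ^ 2 / (1 + mu ^ 2)))
      / (2 * sqrt (Zsq d Rc r mu))).
  - apply (is_derive_sqrt (fun t => Zsq d Rc t mu)); auto.
    unfold Zsq; set (q := (Rc ^ 2 + d ^ 2) / Rc ^ 2).
    set (w := mu ^ 2 / (1 + mu ^ 2)); auto_derive; auto; ring.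
  - unfold Zr; fold (Zcoord d Rc r mu); change (sqrt (Zsq d Rc r mu)) with (Zcoord d Rc r mu).
    set (q := (Rc ^ 2 + d ^ 2) / Rc ^ 2); field; split; [nra|lra].
Qed.

Lemma Zcoord_diff_mu (d Rc r mu : R) : chart d Rc r mu ->
  is_derive (fun t => Zcoord d Rc r t) mu (Zmu d Rc r mu).
Proof.
  intros H; pose proof (Zsq_pos _ _ _ _ H); pose proof (Zcoord_pos _ _ _ _ H).
  replace (Zmu d Rc r mu) with
    (2 * mu * (d ^ 2 - r ^ 2 * ((Rc ^ 2 + d ^ 2) / Rc ^ 2) / (1 + mu ^ 2) ^ 2)
      / (2 * sqrt (Zsq d Rc r mu))).
  - apply (is_derive_sqrt (fun t => Zsq d Rc r t)); auto.
    unfold Zsq; set (q := (Rc ^ 2 + d ^ 2) / Rc ^ 2).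
    auto_derive; [nra|]; field; nra.
  - unfold Zmu; change (sqrt (Zsq d Rc r mu)) with (Zcoord d Rc r mu).
    set (q := (Rc ^ 2 + d ^ 2) / Rc ^ 2); field; split; [nra|lra].
Qed.

Lemma Xcoord_diff_r (d Rc r mu : R) : 0 < d -> 0 < Rc -> chart d Rc r mu ->
  is_derive (fun t => Xcoord d Rc t mu) r
    (- (r + Zcoord d Rc r mu * Zr d Rc r mu) / Xcoord d Rc r mu).
Proof.
  intros Hd HR H; pose proof (Xcoord_pos _ _ _ _ Hd HR H) as HX.
  pose proof (Zcoord_diff_r _ _ _ _ H) as HZ.
  replace (_ / Xcoord d Rc r mu) with
    (- (2 * r + 2 * Zcoord d Rc r mu * Zr d Rc r mu) / (2 * Xcoord d Rc r mu))
    by (field; lra).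
  apply (is_derive_sqrt (fun t => Rc ^ 2 - t ^ 2 - Zcoord d Rc t mu ^ 2)).
  - auto_derive; [eexists; apply HZ|].
    replace (Derive _ r) with (Zr d Rc r mu)
      by (symmetry; apply is_derive_unique, HZ); ring.
  - rewrite <- Xcoord_sq by auto; apply pow_lt, HX.
Qed.

Lemma Xcoord_diff_mu (d Rc r mu : R) : 0 < d -> 0 < Rc -> chart d Rc r mu ->
  is_derive (fun t => Xcoord d Rc r t) mu
    (- (Zcoord d Rc r mu * Zmu d Rc r mu) / Xcoord d Rc r mu).
Proof.
  intros Hd HR H; pose proof (Xcoord_pos _ _ _ _ Hd HR H) as HX.
  pose proof (Zcoord_diff_mu _ _ _ _ H) as HZ.
  replace (_ / Xcoord d Rc r mu) with
    (- (2 * Zcoord d Rc r mu * Zmu d Rc r mu) / (2 * Xcoord d Rc r mu))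
    by (field; lra).
  apply (is_derive_sqrt (fun t => Rc ^ 2 - r ^ 2 - Zcoord d Rc r t ^ 2)).
  - auto_derive; [eexists; apply HZ|].
    replace (Derive _ mu) with (Zmu d Rc r mu)
      by (symmetry; apply is_derive_unique, HZ); ring.
  - rewrite <- Xcoord_sq by auto; apply pow_lt, HX.
Qed.

(* Metric induced on x0^2 + x1^2 + r^2 = Rc^2, for x1 = Z, x0 = X and the
   partial derivatives Za, Zb of Z. *)
Definition graph_metric (r Z X Za Zb : R) (i j : coord) : R :=
  match i, j with
  | Cr, Cr => (r + Z * Za) ^ 2 / X ^ 2 + Za ^ 2 + 1
  | Cr, Cmu | Cmu, Cr => (r + Z * Za) * (Z * Zb) / X ^ 2 + Za * Zb
  | Cmu, Cmu => (Z * Zb) ^ 2 / X ^ 2 + Zb ^ 2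
  | Cphi, Cphi => r ^ 2
  | _, _ => 0
  end.

Lemma metric_chart (d Rc r mu phi : R) (i j : coord) :
  0 < d -> 0 < Rc -> chart d Rc r mu ->
  metric d Rc r mu phi i j
  = graph_metric r (Zcoord d Rc r mu) (Xcoord d Rc r mu)
      (Zr d Rc r mu) (Zmu d Rc r mu) i j.
Proof.
  intros Hd HR H.
  pose proof (Xcoord_pos _ _ _ _ Hd HR H) as HX.
  assert (E : forall k c, pd c (embed d Rc k) r mu phi =
    match k, c with
    | 0%nat, Cr => - (r + Zcoord d Rc r mu * Zr d Rc r mu) / Xcoord d Rc r mu
    | 0%nat, Cmu => - (Zcoord d Rc r mu * Zmu d Rc r mu) / Xcoord d Rc r mu
    | 1%nat, Cr => Zr d Rc r mu
    | 1%nat, Cmu => Zmu d Rc r mu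
    | 2%nat, Cr => cos phi
    | 2%nat, Cphi => - r * sin phi
    | S (S (S _)), Cr => sin phi
    | S (S (S _)), Cphi => r * cos phi
    | _, _ => 0
    end).
  { intros [|[|[|k]]] []; unfold pd, embed; apply is_derive_unique.
    - apply Xcoord_diff_r; auto.
    - apply Xcoord_diff_mu; auto.
    - apply (is_derive_const (V := R_NormedModule)).
    - apply Zcoord_diff_r; auto.
    - apply Zcoord_diff_mu; auto.
    - apply (is_derive_const (V := R_NormedModule)).
    - auto_derive; auto; ring.
    - auto_derive; auto; ring.
    - auto_derive; auto; ring.
    - auto_derive; auto; ring.
    - auto_derive; auto; ring.
    - auto_derive; auto; ring. }
  unfold metric, sum_f_R0; rewrite !E.
  pose proof (sin2_cos2 phi) as SC; unfold Rsqr in SC.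
  destruct i, j; simpl graph_metric; try (field; lra).
  - rewrite Rplus_assoc, (Rplus_comm (cos phi * cos phi)), SC; field; lra.
  - transitivity (r ^ 2 * (sin phi * sin phi + cos phi * cos phi)); [ring|].
    rewrite SC; ring.
Qed.

(** Over (x_1, x_2, x_3) the sphere is the graph of x_0, with volume factor Rc / x_0, and r Zb is up
    to sign the Jacobian of (x_1, x_2, x_3) in (r, mu, phi). *)
Lemma graph_det (Rc r Z X Za Zb : R) :
  X <> 0 -> X ^ 2 = Rc ^ 2 - r ^ 2 - Z ^ 2 ->
  det3 (graph_metric r Z X Za Zb) = (Rc * r * Zb / X) ^ 2.
Proof.
  intros HX E; unfold det3, sum3, cofactor3; simpl nxt; simpl graph_metric.
  replace ((Rc * r * Zb / X) ^ 2) with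
    ((X ^ 2 + r ^ 2 + Z ^ 2) * r ^ 2 * Zb ^ 2 / X ^ 2)
    by (replace (X ^ 2 + r ^ 2 + Z ^ 2) with (Rc ^ 2) by lra; field; auto).
  field; auto.
Qed.

(** On the sphere the gradients of r and Z have the inner products 1 - r^2 / Rc^2, - r Z / Rc^2 and
    1 - Z^2 / Rc^2. The entries with mu then come from dmu = (dZ - Za dr) / Zb. *)
Lemma graph_inv (Rc r Z X Za Zb : R) (i j : coord) :
  Rc <> 0 -> r <> 0 -> Zb <> 0 ->
  X <> 0 -> X ^ 2 = Rc ^ 2 - r ^ 2 - Z ^ 2 ->
  inv3 (graph_metric r Z X Za Zb) i j =
  match i, j with
  | Cr, Cr => 1 - r ^ 2 / Rc ^ 2
  | Cr, Cmu | Cmu, Cr => - (Za * (1 - r ^ 2 / Rc ^ 2) + r * Z / Rc ^ 2) / Zb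
  | Cmu, Cmu => (Za ^ 2 * (1 - r ^ 2 / Rc ^ 2) + 2 * Za * (r * Z / Rc ^ 2)
                 + (1 - Z ^ 2 / Rc ^ 2)) / Zb ^ 2
  | Cphi, Cphi => / r ^ 2
  | _, _ => 0
  end.
Proof.
  intros HR Hr Hb HX E; unfold inv3; rewrite (graph_det Rc) by auto.
  assert (ER : Rc ^ 2 = X ^ 2 + r ^ 2 + Z ^ 2) by lra.
  assert (HR2 : X ^ 2 + r ^ 2 + Z ^ 2 <> 0) by (rewrite <- ER; apply pow_nonzero; auto).
  replace ((Rc * r * Zb / X) ^ 2) with (Rc ^ 2 * r ^ 2 * Zb ^ 2 / X ^ 2)
    by (field; auto).
  rewrite !ER; unfold cofactor3.
  destruct i, j; simpl nxt; simpl graph_metric; field; auto.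
Qed.

(* Multiplied by lapD, the Laplacian becomes polynomial in (d/Rc)^2. *)
Definition lapD (d Rc r mu : R) : R :=
  d ^ 2 * (1 + mu ^ 2) ^ 2 - (Rc ^ 2 + d ^ 2) / Rc ^ 2 * r ^ 2.

Definition gup (d Rc : R) (i j : coord) (r mu : R) : R :=
  match i, j with
  | Cr, Cr => 1 - r ^ 2 / Rc ^ 2
  | Cr, Cmu | Cmu, Cr =>
      r * mu * (1 - d ^ 2 / Rc ^ 2 * mu ^ 2) * (1 + mu ^ 2) / lapD d Rc r mu
  | Cmu, Cmu => (1 + mu ^ 2) ^ 2 * (1 - d ^ 2 / Rc ^ 2 * mu ^ 2) / lapD d Rc r mu
  | Cphi, Cphi => / r ^ 2
  | _, _ => 0
  end.

Definition vol (d Rc r mu : R) : R :=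
  Rc * r * (mu * lapD d Rc r mu / (1 + mu ^ 2) ^ 2)
  / (Zcoord d Rc r mu * Xcoord d Rc r mu).

Lemma lapD_pos (d Rc r mu : R) : 0 < d -> chart d Rc r mu -> 0 < lapD d Rc r mu.
Proof.
  intros Hd (H1 & (H2 & H3) & H4); unfold lapD.
  assert (0 < d ^ 2) by (apply pow_lt; lra); nra.
Qed.

Lemma vol_Zmu (d Rc r mu : R) : 0 < d -> 0 < Rc -> chart d Rc r mu ->
  vol d Rc r mu = Rc * r * Zmu d Rc r mu / Xcoord d Rc r mu.
Proof.
  intros Hd HR H; pose proof (Xcoord_pos _ _ _ _ Hd HR H).
  pose proof (Zcoord_pos _ _ _ _ H).
  unfold vol, Zmu, lapD; field; repeat split; nra.
Qed.

Lemma vol_pos (d Rc r mu : R) : 0 < d -> 0 < Rc -> chart d Rc r mu ->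
  0 < vol d Rc r mu.
Proof.
  intros Hd HR H; rewrite vol_Zmu by auto.
  apply Rdiv_lt_0_compat; [|apply Xcoord_pos; auto].
  apply Rmult_lt_0_compat; [|apply Zmu_pos; auto].
  apply Rmult_lt_0_compat; auto; apply H.
Qed.

Lemma sqrt_det_metric (d Rc r mu phi : R) : 0 < d -> 0 < Rc -> chart d Rc r mu ->
  sqrt (det3 (metric d Rc r mu phi)) = vol d Rc r mu.
Proof.
  intros Hd HR H; pose proof (Xcoord_pos _ _ _ _ Hd HR H) as HX.
  transitivity (sqrt ((Rc * r * Zmu d Rc r mu / Xcoord d Rc r mu) ^ 2)).
  - f_equal; rewrite <- (graph_det Rc r (Zcoord d Rc r mu) (Xcoord d Rc r mu)
      (Zr d Rc r mu) (Zmu d Rc r mu)) by (try lra; apply Xcoord_sq; auto).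
    unfold det3, sum3, cofactor3; rewrite !metric_chart by auto; reflexivity.
  - rewrite <- vol_Zmu by auto; apply sqrt_pow2, Rlt_le, vol_pos; auto.
Qed.

(** [Zr] and [Zmu] both carry the factor 1 / Z, so that only Z^2 survives in the contravariant
    metric; replaced by [Zsq], it leaves a rational function. *)
Lemma inv_metric (d Rc r mu phi : R) (i j : coord) :
  0 < d -> 0 < Rc -> chart d Rc r mu ->
  inv3 (metric d Rc r mu phi) i j = gup d Rc i j r mu.
Proof.
  intros Hd HR H; pose proof (Xcoord_pos _ _ _ _ Hd HR H) as HX.
  pose proof (Zcoord_pos _ _ _ _ H) as HZ.
  pose proof (Zmu_pos _ _ _ _ Hd HR H) as HZm.
  pose proof (lapD_pos _ _ _ _ Hd H) as HD.
  assert (Hr : 0 < r) by apply H.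
  assert (Hm : 0 < mu) by apply H.
  transitivity (inv3 (graph_metric r (Zcoord d Rc r mu) (Xcoord d Rc r mu)
      (Zr d Rc r mu) (Zmu d Rc r mu)) i j).
  { unfold inv3, det3, sum3, cofactor3; rewrite !metric_chart by auto; reflexivity. }
  rewrite (graph_inv Rc) by (try lra; apply Xcoord_sq; auto).
  assert (HD' : (Rc ^ 2 * d ^ 2 * (1 + mu ^ 2) ^ 2 - (Rc ^ 2 + d ^ 2) * r ^ 2) <> 0).
  { replace (_ - _) with (Rc ^ 2 * lapD d Rc r mu)
      by (unfold lapD; field; lra).
    apply Rmult_integral_contrapositive_currified; [|lra].
    apply pow_nonzero; lra. }
  destruct i, j; simpl gup; try reflexivity.
  - transitivity ((r * ((Rc ^ 2 + d ^ 2) / Rc ^ 2) * (mu ^ 2 / (1 + mu ^ 2))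
      * (1 - r ^ 2 / Rc ^ 2) - r * Zcoord d Rc r mu ^ 2 / Rc ^ 2)
      / (mu * lapD d Rc r mu / (1 + mu ^ 2) ^ 2)).
    + unfold Zr, Zmu, lapD; field; repeat split; try nra.
    + rewrite Zcoord_sq by auto; unfold Zsq, lapD; field; repeat split; try nra.
  - transitivity ((r * ((Rc ^ 2 + d ^ 2) / Rc ^ 2) * (mu ^ 2 / (1 + mu ^ 2))
      * (1 - r ^ 2 / Rc ^ 2) - r * Zcoord d Rc r mu ^ 2 / Rc ^ 2)
      / (mu * lapD d Rc r mu / (1 + mu ^ 2) ^ 2)).
    + unfold Zr, Zmu, lapD; field; repeat split; try nra.
    + rewrite Zcoord_sq by auto; unfold Zsq, lapD; field; repeat split; try nra.
  - set (n := r * ((Rc ^ 2 + d ^ 2) / Rc ^ 2) * (mu ^ 2 / (1 + mu ^ 2))).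
    transitivity ((n ^ 2 * (1 - r ^ 2 / Rc ^ 2)
      - 2 * n * r * Zcoord d Rc r mu ^ 2 / Rc ^ 2
      + Zcoord d Rc r mu ^ 2 * (1 - Zcoord d Rc r mu ^ 2 / Rc ^ 2))
      / (mu * lapD d Rc r mu / (1 + mu ^ 2) ^ 2) ^ 2).
    + unfold Zr, Zmu; fold n; unfold lapD; field; repeat split; try nra.
    + rewrite Zcoord_sq by auto; unfold n, Zsq, lapD; field; repeat split; try nra.
Qed.

(** Logarithmic derivatives of [vol]. They are rational, so the square roots disappear from the
    Laplacian once the factor [vol] divides out. *)
Definition dlogvol_r (d Rc r mu : R) : R :=
  / r - 2 * r * ((Rc ^ 2 + d ^ 2) / Rc ^ 2) / lapD d Rc r mu
  + r * ((Rc ^ 2 + d ^ 2) / Rc ^ 2) * (mu ^ 2 / (1 + mu ^ 2)) / Zsq d Rc r mu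
  + (r - r * ((Rc ^ 2 + d ^ 2) / Rc ^ 2) * (mu ^ 2 / (1 + mu ^ 2))) / Xsq d Rc r mu.

Definition dlogvol_mu (d Rc r mu : R) : R :=
  / mu
  + 4 * mu * ((Rc ^ 2 + d ^ 2) / Rc ^ 2) * r ^ 2 / (1 + mu ^ 2) / lapD d Rc r mu
  - mu * lapD d Rc r mu / (1 + mu ^ 2) ^ 2 / Zsq d Rc r mu
  + mu * lapD d Rc r mu / (1 + mu ^ 2) ^ 2 / Xsq d Rc r mu.

Lemma vol_diff_r (d Rc r mu : R) : 0 < d -> 0 < Rc -> chart d Rc r mu ->
  is_derive (fun t => vol d Rc t mu) r (vol d Rc r mu * dlogvol_r d Rc r mu).
Proof.
  intros Hd HR H.
  pose proof (Xcoord_pos _ _ _ _ Hd HR H) as HX.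
  pose proof (Zcoord_pos _ _ _ _ H) as HZ.
  pose proof (lapD_pos _ _ _ _ Hd H) as HD.
  pose proof (Zcoord_diff_r _ _ _ _ H) as DZ.
  pose proof (Xcoord_diff_r _ _ _ _ Hd HR H) as DX.
  assert (EX : Xsq d Rc r mu = Xcoord d Rc r mu ^ 2)
    by (rewrite Xcoord_sq, Zcoord_sq by auto; reflexivity).
  assert (Hr : 0 < r) by apply H.
  assert (Hm : 0 < mu) by apply H.
  assert (K1 : 1 + mu ^ 2 <> 0) by nra.
  assert (K2 : Zcoord d Rc r mu * Xcoord d Rc r mu <> 0)
    by (apply Rgt_not_eq, Rmult_lt_0_compat; auto).
  unfold dlogvol_r; rewrite EX, <- (Zcoord_sq d Rc r mu) by auto.
  unfold vol, lapD in *; set (q := (Rc ^ 2 + d ^ 2) / Rc ^ 2) in *.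
  auto_derive.
  - split; [eexists; exact DZ|]; split; [eexists; exact DX|auto].
  - replace (Derive (fun t => Zcoord d Rc t mu) r) with (Zr d Rc r mu)
      by (symmetry; apply is_derive_unique, DZ).
    replace (Derive (fun t => Xcoord d Rc t mu) r)
      with (- (r + Zcoord d Rc r mu * Zr d Rc r mu) / Xcoord d Rc r mu)
      by (symmetry; apply is_derive_unique, DX).
    unfold Zr; fold q; field; repeat split; first [assumption|lra].
Qed.

Lemma vol_diff_mu (d Rc r mu : R) : 0 < d -> 0 < Rc -> chart d Rc r mu ->
  is_derive (fun t => vol d Rc r t) mu (vol d Rc r mu * dlogvol_mu d Rc r mu).
Proof.
  intros Hd HR H.
  pose proof (Xcoord_pos _ _ _ _ Hd HR H) as HX.
  pose proof (Zcoord_pos _ _ _ _ H) as HZ.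
  pose proof (lapD_pos _ _ _ _ Hd H) as HD.
  pose proof (Zcoord_diff_mu _ _ _ _ H) as DZ.
  pose proof (Xcoord_diff_mu _ _ _ _ Hd HR H) as DX.
  assert (EX : Xsq d Rc r mu = Xcoord d Rc r mu ^ 2)
    by (rewrite Xcoord_sq, Zcoord_sq by auto; reflexivity).
  assert (Hr : 0 < r) by apply H.
  assert (Hm : 0 < mu) by apply H.
  assert (K1 : 1 + mu ^ 2 <> 0) by nra.
  assert (K2 : Zcoord d Rc r mu * Xcoord d Rc r mu <> 0)
    by (apply Rgt_not_eq, Rmult_lt_0_compat; auto).
  unfold dlogvol_mu; rewrite EX, <- (Zcoord_sq d Rc r mu) by auto.
  unfold vol, lapD in *; set (q := (Rc ^ 2 + d ^ 2) / Rc ^ 2) in *.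
  auto_derive.
  - split; [nra|]; split; [eexists; exact DZ|]; split; [eexists; exact DX|auto].
  - replace (Derive (fun t => Zcoord d Rc r t) mu) with (Zmu d Rc r mu)
      by (symmetry; apply is_derive_unique, DZ).
    replace (Derive (fun t => Xcoord d Rc r t) mu)
      with (- (Zcoord d Rc r mu * Zmu d Rc r mu) / Xcoord d Rc r mu)
      by (symmetry; apply is_derive_unique, DX).
    unfold Zmu; fold q; field; repeat split; first [assumption|lra].
Qed.

Lemma gup_rr_diff (d Rc r mu : R) : 0 < Rc ->
  is_derive (fun t => gup d Rc Cr Cr t mu) r (- (2 * r / Rc ^ 2)).
Proof.
  intros HR; unfold gup; auto_derive; [|field]; lra.
Qed.

Definition gup_rmu_r (d Rc r mu : R) : R :=
  mu * (1 - d ^ 2 / Rc ^ 2 * mu ^ 2) * (1 + mu ^ 2) / lapD d Rc r mu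
  + 2 * ((Rc ^ 2 + d ^ 2) / Rc ^ 2) * r ^ 2 * mu * (1 - d ^ 2 / Rc ^ 2 * mu ^ 2)
    * (1 + mu ^ 2) / lapD d Rc r mu ^ 2.

Definition gup_rmu_mu (d Rc r mu : R) : R :=
  r * (1 + 3 * mu ^ 2 - d ^ 2 / Rc ^ 2 * (3 * mu ^ 2 + 5 * mu ^ 4)) / lapD d Rc r mu
  - r * mu * (1 - d ^ 2 / Rc ^ 2 * mu ^ 2) * (1 + mu ^ 2)
    * (4 * d ^ 2 * mu * (1 + mu ^ 2)) / lapD d Rc r mu ^ 2.

Definition gup_mumu_mu (d Rc r mu : R) : R :=
  (4 * mu * (1 + mu ^ 2) * (1 - d ^ 2 / Rc ^ 2 * mu ^ 2)
   - 2 * mu * (1 + mu ^ 2) ^ 2 * (d ^ 2 / Rc ^ 2)) / lapD d Rc r mu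
  - (1 + mu ^ 2) ^ 2 * (1 - d ^ 2 / Rc ^ 2 * mu ^ 2)
    * (4 * d ^ 2 * mu * (1 + mu ^ 2)) / lapD d Rc r mu ^ 2.

Lemma gup_rmu_diff_r (d Rc r mu : R) : 0 < d -> chart d Rc r mu ->
  is_derive (fun t => gup d Rc Cr Cmu t mu) r (gup_rmu_r d Rc r mu).
Proof.
  intros Hd H; pose proof (lapD_pos _ _ _ _ Hd H) as HD.
  unfold gup_rmu_r; unfold gup; unfold lapD in *.
  set (q := (Rc ^ 2 + d ^ 2) / Rc ^ 2) in *; set (e := d ^ 2 / Rc ^ 2).
  auto_derive; [|field]; lra.
Qed.

Lemma gup_rmu_diff_mu (d Rc r mu : R) : 0 < d -> chart d Rc r mu ->
  is_derive (fun t => gup d Rc Cmu Cr r t) mu (gup_rmu_mu d Rc r mu).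
Proof.
  intros Hd H; pose proof (lapD_pos _ _ _ _ Hd H) as HD.
  unfold gup_rmu_mu; unfold gup; unfold lapD in *.
  set (q := (Rc ^ 2 + d ^ 2) / Rc ^ 2) in *; set (e := d ^ 2 / Rc ^ 2).
  auto_derive; [|field]; lra.
Qed.

Lemma gup_mumu_diff (d Rc r mu : R) : 0 < d -> chart d Rc r mu ->
  is_derive (fun t => gup d Rc Cmu Cmu r t) mu (gup_mumu_mu d Rc r mu).
Proof.
  intros Hd H; pose proof (lapD_pos _ _ _ _ Hd H) as HD.
  unfold gup_mumu_mu; unfold gup; unfold lapD in *.
  set (q := (Rc ^ 2 + d ^ 2) / Rc ^ 2) in *; set (e := d ^ 2 / Rc ^ 2).
  auto_derive; [|field]; lra.
Qed.


(** These are the nonvanishing conditions that [field] leaves in the two simplifications below,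
    stated in the shape in which they arise there. *)
Lemma laplacian_denominators (d Rc r mu : R) :
  0 < d -> 0 < Rc -> chart d Rc r mu ->
  Rc <> 0 /\ r <> 0 /\ mu <> 0 /\ 1 + mu ^ 2 <> 0 /\
  Rc ^ 2 * (1 + mu ^ 2) - r ^ 2 <> 0 /\
  Rc ^ 2 - (d * mu) ^ 2 <> 0 /\
  (d * mu) ^ 2 * (Rc ^ 2 * (1 + mu ^ 2)) - r ^ 2 * (Rc ^ 2 + d ^ 2) * mu ^ 2 <> 0 /\
  (d * (1 + mu ^ 2) * Rc) ^ 2 - (Rc ^ 2 + d ^ 2) * r ^ 2 <> 0.
Proof.
  intros Hd HR H; pose proof (lapD_pos _ _ _ _ Hd H) as HD.
  pose proof (Zsq_pos _ _ _ _ H) as HZ.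
  pose proof (chart_div_bound _ _ _ _ Hd HR H) as (B1 & B2 & _).
  assert (Hr : 0 < r) by apply H.
  assert (Hm : 0 < mu) by apply H.
  assert (HR2 : 0 < Rc ^ 2) by (apply pow_lt; auto).
  repeat split; try lra; try nra.
  - assert (0 < d * mu) by (apply Rmult_lt_0_compat; auto).
    assert ((d * mu) ^ 2 < Rc ^ 2) by (apply pow_incr_lt || nra); lra.
  - apply Rgt_not_eq.
    replace (_ - _) with (Rc ^ 2 * (1 + mu ^ 2) * Zsq d Rc r mu)
      by (unfold Zsq; field; split; nra).
    repeat apply Rmult_lt_0_compat; nra.
  - apply Rgt_not_eq.
    replace (_ - _) with (Rc ^ 2 * lapD d Rc r mu) by (unfold lapD; field; lra).
    apply Rmult_lt_0_compat; auto.
Qed.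

(** The first-order coefficient of the r-derivative is the Laplacian of the function r. In R^4 this
    function is homogeneous of degree 1 with flat Laplacian 1 / r; restriction to the three-sphere
    subtracts 3 r / Rc^2. *)
Lemma laplacian_r (d Rc r mu : R) : 0 < d -> 0 < Rc -> chart d Rc r mu ->
  - (2 * r / Rc ^ 2) + gup d Rc Cr Cr r mu * dlogvol_r d Rc r mu
  + (gup_rmu_mu d Rc r mu + gup d Rc Cmu Cr r mu * dlogvol_mu d Rc r mu)
  = / r - 3 * r / Rc ^ 2.
Proof.
  intros Hd HR H.
  pose proof (laplacian_denominators _ _ _ _ Hd HR H) as (N1 & N2 & N3 & N).
  unfold dlogvol_r, dlogvol_mu, gup_rmu_mu, gup.
  rewrite Xsq_factor by auto.
  unfold Zsq, lapD; field; tauto.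
Qed.

(** This is the Laplacian of the function mu. All mixed denominators cancel except [lapD], which is
    why multiplication by [lapD] suffices to make the coefficients polynomial in (d/Rc)^2. *)
Lemma laplacian_mu (d Rc r mu : R) : 0 < d -> 0 < Rc -> chart d Rc r mu ->
  gup_rmu_r d Rc r mu + gup d Rc Cr Cmu r mu * dlogvol_r d Rc r mu
  + (gup_mumu_mu d Rc r mu + gup d Rc Cmu Cmu r mu * dlogvol_mu d Rc r mu)
  = (1 + mu ^ 2) * mu * (2 - d ^ 2 / Rc ^ 2 * (1 + 3 * mu ^ 2)) / lapD d Rc r mu.
Proof.
  intros Hd HR H.
  pose proof (laplacian_denominators _ _ _ _ Hd HR H) as (N1 & N2 & N3 & N).
  unfold dlogvol_r, dlogvol_mu, gup_rmu_r, gup_mumu_mu, gup.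
  rewrite Xsq_factor by auto.
  unfold Zsq, lapD; field; tauto.
Qed.

(** * The Laplacian in divergence form *)

Lemma is_derive_mult3 (f g h : R -> R) (x f' g' h' : R) :
  is_derive f x f' -> is_derive g x g' -> is_derive h x h' ->
  is_derive (fun t => f t * g t * h t) x
    (f' * g x * h x + f x * g' * h x + f x * g x * h').
Proof.
  intros Hf Hg Hh; auto_derive; [repeat split; eexists; eassumption|].
  replace (Derive _ x) with f' by (symmetry; apply is_derive_unique, Hf).
  replace (Derive _ x) with g' by (symmetry; apply is_derive_unique, Hg).
  replace (Derive _ x) with h' by (symmetry; apply is_derive_unique, Hh).
  ring.
Qed.

(** One summand of the divergence, with g in the role of the j-th partial derivative of the
    function. [vol] is kept as a common factor, to cancel against the prefactor of the operator. *)
Lemma flux_diff_r (d Rc r mu phi dG dg : R) (j : coord) (g : R -> R) :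
  0 < d -> 0 < Rc -> chart d Rc r mu ->
  is_derive (fun t => gup d Rc Cr j t mu) r dG -> is_derive g r dg ->
  Derive (fun t => sqrt (det3 (metric d Rc t mu phi))
                   * inv3 (metric d Rc t mu phi) Cr j * g t) r
  = vol d Rc r mu * ((dG + gup d Rc Cr j r mu * dlogvol_r d Rc r mu) * g r
                     + gup d Rc Cr j r mu * dg).
Proof.
  intros Hd HR H HG Hg; apply is_derive_unique.
  apply (is_derive_ext_loc (fun t => vol d Rc t mu * gup d Rc Cr j t mu * g t)).
  - generalize (locally_2d_1d_const_y _ _ _ (chart_locally _ _ _ _ H)).
    apply filter_imp; intros t Ht; rewrite sqrt_det_metric, inv_metric; auto.
  - replace (vol d Rc r mu * _) with
      (vol d Rc r mu * dlogvol_r d Rc r mu * gup d Rc Cr j r mu * g r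
       + vol d Rc r mu * dG * g r + vol d Rc r mu * gup d Rc Cr j r mu * dg) by ring.
    apply (is_derive_mult3 (fun t => vol d Rc t mu) (fun t => gup d Rc Cr j t mu));
      auto using vol_diff_r.
Qed.

Lemma flux_diff_mu (d Rc r mu phi dG dg : R) (j : coord) (g : R -> R) :
  0 < d -> 0 < Rc -> chart d Rc r mu ->
  is_derive (fun t => gup d Rc Cmu j r t) mu dG -> is_derive g mu dg ->
  Derive (fun t => sqrt (det3 (metric d Rc r t phi))
                   * inv3 (metric d Rc r t phi) Cmu j * g t) mu
  = vol d Rc r mu * ((dG + gup d Rc Cmu j r mu * dlogvol_mu d Rc r mu) * g mu
                     + gup d Rc Cmu j r mu * dg).
Proof.
  intros Hd HR H HG Hg; apply is_derive_unique.
  apply (is_derive_ext_loc (fun t => vol d Rc r t * gup d Rc Cmu j r t * g t)).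
  - generalize (locally_2d_1d_const_x _ _ _ (chart_locally _ _ _ _ H)).
    apply filter_imp; intros t Ht; rewrite sqrt_det_metric, inv_metric; auto.
  - replace (vol d Rc r mu * _) with
      (vol d Rc r mu * dlogvol_mu d Rc r mu * gup d Rc Cmu j r mu * g mu
       + vol d Rc r mu * dG * g mu + vol d Rc r mu * gup d Rc Cmu j r mu * dg) by ring.
    apply (is_derive_mult3 (fun t => vol d Rc r t) (fun t => gup d Rc Cmu j r t));
      auto using vol_diff_mu.
Qed.

(** Both orders of the mixed derivative occur in the Laplacian. Their equality is Schwarz' theorem,
    which is the reason for asking differentiability in a neighbourhood. *)
Lemma ex_diff_2_partials (U : R -> R -> R) (r mu : R) :
  locally_2d (ex_diff_n U 2) r mu ->
  is_derive (fun t => U t mu) r (partial_derive 1 0 U r mu) /\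
  is_derive (fun t => U r t) mu (partial_derive 0 1 U r mu) /\
  is_derive (fun t => Derive (fun x => U x mu) t) r (partial_derive 2 0 U r mu) /\
  is_derive (fun t => Derive (fun x => U r x) t) mu (partial_derive 0 2 U r mu) /\
  is_derive (fun t => Derive (fun x => U t x) mu) r (partial_derive 1 1 U r mu) /\
  is_derive (fun t => Derive (fun x => U x t) r) mu (partial_derive 1 1 U r mu).
Proof.
  intros L; pose proof (locally_2d_singleton _ _ _ L) as H; simpl in H.
  destruct H as (_ & H1 & H2 & (_ & H3 & H4 & H5 & H6) & (_ & H7 & H8 & H9 & H10)).
  split; [exact (Derive_correct _ _ H1)|].
  split; [exact (Derive_correct _ _ H2)|].
  split; [exact (Derive_correct _ _ H3)|].
  split; [exact (Derive_correct _ _ H8)|].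
  split; [exact (Derive_correct _ _ H7)|].
  replace (partial_derive 1 1 U r mu)
    with (Derive (fun t => Derive (fun x => U x t) r) mu);
    [exact (Derive_correct _ _ H4)|].
  symmetry; apply Schwarz; try tauto.
  revert L; apply locally_2d_impl, locally_2d_forall; simpl; tauto.
Qed.

Lemma laplace_beltrami_chart (d Rc r mu phi : R) (U : R -> R -> R) :
  0 < d -> 0 < Rc -> chart d Rc r mu -> locally_2d (ex_diff_n U 2) r mu ->
  lapD d Rc r mu * laplace_beltrami d Rc (fun r' mu' _ => U r' mu') r mu phi
  = lapD d Rc r mu * (1 - r ^ 2 / Rc ^ 2) * partial_derive 2 0 U r mu
    + 2 * r * mu * (1 - d ^ 2 / Rc ^ 2 * mu ^ 2) * (1 + mu ^ 2)
      * partial_derive 1 1 U r mu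
    + (1 + mu ^ 2) ^ 2 * (1 - d ^ 2 / Rc ^ 2 * mu ^ 2) * partial_derive 0 2 U r mu
    + lapD d Rc r mu * (/ r - 3 * r / Rc ^ 2) * partial_derive 1 0 U r mu
    + (1 + mu ^ 2) * mu * (2 - d ^ 2 / Rc ^ 2 * (1 + 3 * mu ^ 2))
      * partial_derive 0 1 U r mu.
Proof.
  intros Hd HR H L.
  pose proof (lapD_pos _ _ _ _ Hd H) as HD.
  pose proof (vol_pos _ _ _ _ Hd HR H) as HV.
  pose proof (ex_diff_2_partials _ _ _ L) as (_ & _ & H20 & H02 & H11 & H11').
  (* All terms with an index phi drop out: U does not depend on phi, and the contravariant metric
     has no entries mixing phi with r or mu. *)
  assert (Nr : forall i, pd i (fun r' mu' phi' =>
      sqrt (det3 (metric d Rc r' mu' phi'))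
      * inv3 (metric d Rc r' mu' phi') i Cphi
      * pd Cphi (fun r' mu' _ => U r' mu') r' mu' phi') r mu phi = 0).
  { intros i; destruct i; unfold pd at 1;
      (erewrite Derive_ext; [apply (Derive_const 0)|]; intros t;
       unfold pd; rewrite Derive_const; ring). }
  assert (Nl : forall j, j <> Cphi -> pd Cphi (fun r' mu' phi' =>
      sqrt (det3 (metric d Rc r' mu' phi'))
      * inv3 (metric d Rc r' mu' phi') Cphi j
      * pd j (fun r' mu' _ => U r' mu') r' mu' phi') r mu phi = 0).
  { intros j Hj; unfold pd at 1.
    erewrite Derive_ext; [apply (Derive_const 0)|]; intros t.
    rewrite inv_metric by auto; destruct j; simpl gup; try ring; tauto. }
  unfold laplace_beltrami, sum3.
  rewrite !Nr, !Nl by discriminate.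
  rewrite sqrt_det_metric by auto.
  unfold pd.
  rewrite (flux_diff_r d Rc r mu phi _ _ Cr
    (fun t => Derive (fun x => U x mu) t) Hd HR H (gup_rr_diff d Rc r mu HR) H20).
  rewrite (flux_diff_r d Rc r mu phi _ _ Cmu
    (fun t => Derive (fun x => U t x) mu) Hd HR H (gup_rmu_diff_r d Rc r mu Hd H) H11).
  rewrite (flux_diff_mu d Rc r mu phi _ _ Cr
    (fun t => Derive (fun x => U x t) r) Hd HR H (gup_rmu_diff_mu d Rc r mu Hd H) H11').
  rewrite (flux_diff_mu d Rc r mu phi _ _ Cmu
    (fun t => Derive (fun x => U r x) t) Hd HR H (gup_mumu_diff d Rc r mu Hd H) H02).
  pose proof (laplacian_r _ _ _ _ Hd HR H) as E1.
  pose proof (laplacian_mu _ _ _ _ Hd HR H) as E2.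
  change (Derive (fun x => U x mu) r) with (partial_derive 1 0 U r mu).
  change (Derive (fun x => U r x) mu) with (partial_derive 0 1 U r mu).
  set (L1 := dlogvol_r d Rc r mu) in *; set (L2 := dlogvol_mu d Rc r mu) in *.
  set (f10 := partial_derive 1 0 U r mu); set (f01 := partial_derive 0 1 U r mu).
  set (f20 := partial_derive 2 0 U r mu); set (f02 := partial_derive 0 2 U r mu).
  set (f11 := partial_derive 1 1 U r mu).
  transitivity (lapD d Rc r mu * (
    (/ r - 3 * r / Rc ^ 2) * f10
    + (1 + mu ^ 2) * mu * (2 - d ^ 2 / Rc ^ 2 * (1 + 3 * mu ^ 2)) / lapD d Rc r mu * f01
    + gup d Rc Cr Cr r mu * f20 + gup d Rc Cmu Cmu r mu * f02
    + (gup d Rc Cr Cmu r mu + gup d Rc Cmu Cr r mu) * f11)).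
  - rewrite <- E1, <- E2; field; lra.
  - assert (Hr : 0 < r) by apply H; unfold gup.
    set (D := lapD d Rc r mu) in *; field; lra.
Qed.

(** * Expansion in (d/Rc)^2 *)

(** Outside the closed disc of convergence the terms do not tend to 0, so convergence at a single
    nonzero point is enough. *)
Lemma CV_radius_pos (c : nat -> R) (x l : R) :
  x <> 0 -> is_pseries c x l -> Rbar_lt 0 (CV_radius c).
Proof.
  intros Hx H; apply is_pseries_R in H.
  destruct (Rbar_lt_dec 0 (CV_radius c)) as [|N]; auto; exfalso.
  apply Rbar_not_lt_le in N.
  apply (CV_disk_outside c x).
  - eapply Rbar_le_lt_trans; [exact N|]; apply Rabs_pos_lt, Hx.
  - apply ex_series_lim_0; eexists; exact H.
Qed.

Lemma is_derive_PSeries_0 (c : nat -> R) (x l : R) :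
  x <> 0 -> is_pseries c x l -> is_derive (PSeries c) 0 (c 1%nat).
Proof.
  intros Hx H.
  replace (c 1%nat) with (PSeries (PS_derive c) 0)
    by (rewrite PSeries_0; unfold PS_derive; simpl; ring).
  apply is_derive_PSeries; rewrite Rabs_R0; eapply CV_radius_pos; eauto.
Qed.

(** The Poisson equation speaks about e = (d/Rc)^2 > 0 only, whereas the coefficients of the
    expansion are read off at e = 0. Where the derivative at 0 exists, its right half determines
    it. *)
Lemma derive_zero_right (T : R -> R) (l del : R) :
  0 < del -> (forall x, 0 < x < del -> T x = 0) -> is_derive T 0 l ->
  T 0 = 0 /\ l = 0.
Proof.
  intros Hdel HT HD.
  assert (T0 : T 0 = 0).
  { destruct (Req_dec (T 0) 0) as [|N]; auto; exfalso.
    assert (HC : continuity_pt T 0) by (apply ex_derive_continuity_pt; eexists; exact HD).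
    destruct (HC (Rabs (T 0)) (Rabs_pos_lt _ N)) as (a & Ha & Hc).
    set (h := Rmin a del / 2).
    assert (0 < h < del /\ h < a)
      by (unfold h; pose proof (Rmin_l a del); pose proof (Rmin_r a del);
          assert (0 < Rmin a del) by (apply Rmin_glb_lt; lra); lra).
    specialize (Hc h); simpl in Hc; unfold R_dist in Hc.
    rewrite HT in Hc by lra.
    replace (0 - T 0) with (- T 0) in Hc by ring; rewrite Rabs_Ropp in Hc.
    apply (Rlt_irrefl (Rabs (T 0))), Hc; split.
    - split; [exact I|lra].
    - rewrite Rminus_0_r, Rabs_pos_eq; lra. }
  split; auto.
  destruct (Req_dec l 0) as [|N]; auto; exfalso.
  apply is_derive_Reals in HD.
  destruct (HD (Rabs l) (Rabs_pos_lt _ N)) as (a & Hc).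
  set (h := Rmin a del / 2).
  assert (0 < h < del /\ h < a)
    by (unfold h; pose proof (Rmin_l a del); pose proof (Rmin_r a del);
        assert (0 < Rmin a del) by (apply Rmin_glb_lt; [apply a|lra]); lra).
  specialize (Hc h); rewrite Rplus_0_l, HT, T0 in Hc by lra.
  replace ((0 - 0) / h - l) with (- l) in Hc by (field; lra).
  rewrite Rabs_Ropp in Hc.
  apply (Rlt_irrefl (Rabs l)), Hc; [lra|rewrite Rabs_pos_eq; lra].
Qed.

(** * Derivatives of the coefficients U_n *)

(** Differentiability is demanded in a neighbourhood, as [Derive_n_plus] and the differentiation of
    pointwise identities require. *)
Definition smooth2 (f : R -> R) (x : R) : Prop :=
  locally x (fun t => forall j, (j <= 2)%nat -> ex_derive_n f j t).

Lemma smooth2_locally (f : R -> R) (x : R) :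
  smooth2 f x -> locally x (smooth2 f).
Proof. apply locally_locally. Qed.

Lemma smooth2_derive (f : R -> R) (x : R) : smooth2 f x ->
  is_derive f x (Derive f x) /\ is_derive (Derive f) x (Derive_n f 2 x).
Proof.
  intros H; apply locally_singleton in H.
  split; apply Derive_correct; [apply (H 1%nat)|apply (H 2%nat)]; lia.
Qed.

Lemma smooth2_of_derives (f f' f'' : R -> R) (x : R) :
  locally x (fun t => is_derive f t (f' t)) ->
  locally x (fun t => is_derive f' t (f'' t)) ->
  smooth2 f x /\ Derive f x = f' x /\ Derive_n f 2 x = f'' x.
Proof.
  intros H1 H2.
  assert (E1 : locally x (fun t => Derive f t = f' t))
    by (revert H1; apply filter_imp; intros; apply is_derive_unique; auto).
  assert (K : locally x (fun t => is_derive (Derive f) t (f'' t))).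
  { generalize (filter_and _ _ H2 (locally_locally _ _ E1)).
    apply filter_imp; intros t [A B].
    eapply is_derive_ext_loc; [|exact A].
    revert B; apply filter_imp; intros; auto. }
  split; [|split].
  - unfold smooth2; generalize (filter_and _ _ H1 K); apply filter_imp.
    intros t [A B] [|[|[|j]]] Hj; [exact I| | |lia].
    + eexists; exact A.
    + eexists; exact B.
  - apply locally_singleton in E1; auto.
  - apply is_derive_unique; apply locally_singleton in K; auto.
Qed.

Lemma smooth2_mult (f g : R -> R) (x : R) : smooth2 f x -> smooth2 g x ->
  smooth2 (fun t => f t * g t) x /\
  Derive (fun t => f t * g t) x = Derive f x * g x + f x * Derive g x /\
  Derive_n (fun t => f t * g t) 2 x
  = Derive_n f 2 x * g x + 2 * Derive f x * Derive g x + f x * Derive_n g 2 x.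
Proof.
  intros Hf Hg.
  apply (smooth2_of_derives (fun t => f t * g t)
    (fun t => Derive f t * g t + f t * Derive g t)
    (fun t => Derive_n f 2 t * g t + 2 * Derive f t * Derive g t + f t * Derive_n g 2 t));
    generalize (filter_and _ _ (smooth2_locally _ _ Hf) (smooth2_locally _ _ Hg));
    apply filter_imp; intros t [A B];
    destruct (smooth2_derive _ _ A) as [A1 A2], (smooth2_derive _ _ B) as [B1 B2].
  - apply (is_derive_mult f g); auto using Rmult_comm.
  - replace (_ + _) with
      ((Derive_n f 2 t * g t + Derive f t * Derive g t)
       + (Derive f t * Derive g t + f t * Derive_n g 2 t)) by ring.
    apply (is_derive_plus (fun t => Derive f t * g t) (fun t => f t * Derive g t)).
    + apply (is_derive_mult (Derive f) g); auto using Rmult_comm.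
    + apply (is_derive_mult f (Derive g)); auto using Rmult_comm.
Qed.

Definition weight (m : nat) (y : R) : R := / (2 ^ m * (1 + y ^ 2) ^ m).

Lemma smooth2_weight (m : nat) (x : R) : smooth2 (weight m) x.
Proof.
  assert (P : forall y, 0 < 1 + y ^ 2) by (intros; nra).
  assert (Q : forall k y, 0 < 2 ^ k * (1 + y ^ 2) ^ k)
    by (intros; apply Rmult_lt_0_compat; apply pow_lt; auto; lra).
  (* Only the existence of the second derivative matters here, so it is left as a [Derive]. *)
  apply (smooth2_of_derives (weight m)
    (fun y => - (2 ^ m * (INR m * (2 * y) * (1 + y ^ 2) ^ pred m))
              / (2 ^ m * (1 + y ^ 2) ^ m) ^ 2)
    (Derive (fun y => - (2 ^ m * (INR m * (2 * y) * (1 + y ^ 2) ^ pred m))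
              / (2 ^ m * (1 + y ^ 2) ^ m) ^ 2)));
    apply filter_forall; intros y; specialize (Q m y); unfold weight.
  - auto_derive; [apply Rgt_not_eq, Q|].
    replace (1 + y * (y * 1)) with (1 + y ^ 2) by ring.
    field; split; [apply pow_nonzero, Rgt_not_eq, P|apply pow_nonzero; lra].
  - apply Derive_correct; auto_derive.
    replace (1 + y * (y * 1)) with (1 + y ^ 2) by ring.
    nra.
Qed.

Lemma Derive_n_lincomb (w : nat -> R -> R) (c : nat -> R) (M k : nat) (x : R) :
  (k <= 2)%nat -> (forall m, (m <= M)%nat -> smooth2 (w m) x) ->
  Derive_n (fun z => sum_f_R0 (fun m => c m * w m z) M) k x
  = sum_f_R0 (fun m => c m * Derive_n (w m) k x) M.
Proof.
  intros Hk; induction M as [|M IH]; intros H.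
  - simpl; apply Derive_n_scal_l.
  - simpl.
    assert (Hsm : forall N, (N <= S M)%nat ->
      locally x (fun y => forall j, (j <= k)%nat ->
        ex_derive_n (fun z => sum_f_R0 (fun m => c m * w m z) N) j y)).
    { induction N as [|N IHN]; intros HN.
      - assert (Q := H 0%nat (Nat.le_0_l _)); revert Q; unfold smooth2; apply filter_imp.
        intros y Hy j Hj; simpl; apply ex_derive_n_scal_l, Hy; lia.
      - assert (L1 := IHN ltac:(lia)).
        assert (L2 : locally x (fun y => forall j, (j <= k)%nat ->
          ex_derive_n (fun z => c (S N) * w (S N) z) j y)).
        { assert (Q := H (S N) HN); revert Q; unfold smooth2; apply filter_imp.
          intros y Hy j Hj; apply ex_derive_n_scal_l, Hy; lia. }
        generalize (filter_and _ _ (locally_locally _ _ L1) (locally_locally _ _ L2)).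
        apply filter_imp; intros y [A B] j Hj; simpl.
        apply ex_derive_n_plus; [revert A|revert B]; apply filter_imp; intros z Hz i Hi;
          apply Hz; lia. }
    rewrite Derive_n_plus.
    + rewrite IH, Derive_n_scal_l; auto.
    + apply Hsm; lia.
    + assert (Q := H (S M) (le_n _)); revert Q; unfold smooth2; apply filter_imp.
      intros y Hy j Hj; apply ex_derive_n_scal_l, Hy; lia.
Qed.

(** With the weight absorbed, [Ucoef] is a polynomial in r / d whose coefficients depend on mu
    alone, so that differentiations in r and in mu separate. *)
Definition wcoef (v : nat -> R -> R) (m : nat) (y : R) : R := v m y * weight m y.

Lemma Ucoef_partial (d r mu : R) (v : nat -> R -> R) (M j k : nat) :
  (k <= 2)%nat -> (forall m, (m <= M)%nat -> smooth2 (v m) mu) ->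
  partial_derive j k (Ucoef d v M) r mu
  = Derive_n (fun t => sum_f_R0 (fun m => (t / d) ^ (2 * m) *
      Derive_n (wcoef v m) k mu) M) j r.
Proof.
  intros Hk H; unfold partial_derive; apply Derive_n_ext; intros t.
  apply (Derive_n_lincomb (wcoef v) (fun m => (t / d) ^ (2 * m))); auto.
  intros m Hm; apply smooth2_mult; auto using smooth2_weight.
Qed.

Lemma Derive_n_quadratic (d r : R) (c : nat -> R) : d <> 0 ->
  Derive_n (fun t => sum_f_R0 (fun m => (t / d) ^ (2 * m) * c m) 1) 1 r
  = 2 * r / d ^ 2 * c 1%nat /\
  Derive_n (fun t => sum_f_R0 (fun m => (t / d) ^ (2 * m) * c m) 1) 2 r
  = 2 / d ^ 2 * c 1%nat.
Proof.
  intros Hd.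
  assert (E : forall t, Derive (fun t => sum_f_R0 (fun m => (t / d) ^ (2 * m) * c m) 1) t
    = 2 * t / d ^ 2 * c 1%nat).
  { intros t; apply is_derive_unique; simpl; auto_derive; auto; field; auto. }
  split; [apply E|]; simpl Derive_n.
  transitivity (Derive (fun t => 2 * t / d ^ 2 * c 1%nat) r).
  - apply Derive_ext; intros t; apply E.
  - apply is_derive_unique; auto_derive; auto; field; auto.
Qed.

Lemma Derive_n_quartic (d r : R) (c : nat -> R) : d <> 0 ->
  Derive_n (fun t => sum_f_R0 (fun m => (t / d) ^ (2 * m) * c m) 2) 1 r
  = 2 * r / d ^ 2 * c 1%nat + 4 * r ^ 3 / d ^ 4 * c 2%nat /\
  Derive_n (fun t => sum_f_R0 (fun m => (t / d) ^ (2 * m) * c m) 2) 2 r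
  = 2 / d ^ 2 * c 1%nat + 12 * r ^ 2 / d ^ 4 * c 2%nat.
Proof.
  intros Hd.
  assert (E : forall t, Derive (fun t => sum_f_R0 (fun m => (t / d) ^ (2 * m) * c m) 2) t
    = 2 * t / d ^ 2 * c 1%nat + 4 * t ^ 3 / d ^ 4 * c 2%nat).
  { intros t; apply is_derive_unique; simpl; auto_derive; auto; field; auto. }
  split; [apply E|]; simpl Derive_n.
  transitivity (Derive (fun t => 2 * t / d ^ 2 * c 1%nat + 4 * t ^ 3 / d ^ 4 * c 2%nat) r).
  - apply Derive_ext; intros t; apply E.
  - apply is_derive_unique; auto_derive; auto; field; auto.
Qed.

(** * Comparison of coefficients in the Poisson equation *)

(** The substitution Rc = d / sqrt e makes e = (d/Rc)^2 the independent variable. *)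
Lemma radius_of_ratio (d Rm e : R) : 0 < d -> 0 < Rm -> 0 < e < (d / Rm) ^ 2 ->
  Rm < d / sqrt e /\ (d / (d / sqrt e)) ^ 2 = e /\
  d ^ 2 / (d / sqrt e) ^ 2 = e.
Proof.
  intros Hd HR He.
  assert (Hs : 0 < sqrt e) by (apply sqrt_lt_R0; lra).
  assert (Hs2 : sqrt e ^ 2 = e) by (apply pow2_sqrt; lra).
  split; [|split].
  - apply Rlt_div_r; auto.
    assert (sqrt e < d / Rm).
    { apply Rsqr_incrst_0; try lra; [unfold Rsqr; nra|].
      apply Rlt_le, Rdiv_lt_0_compat; auto. }
    apply Rmult_lt_compat_l with (r := Rm) in H; auto.
    replace (Rm * (d / Rm)) with d in H by (field; lra); lra.
  - rewrite <- Hs2 at 2; field; lra.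
  - rewrite <- Hs2 at 2; field; lra.
Qed.

Lemma chart_of_ratio (d Rc r mu : R) : 0 < d -> 0 < Rc ->
  0 < r -> 0 < mu -> d * mu < Rc ->
  r ^ 2 * (1 + d ^ 2 / Rc ^ 2) < d ^ 2 * (1 + mu ^ 2) -> chart d Rc r mu.
Proof.
  intros Hd HR Hr Hm HmR H; repeat split; auto.
  - apply Rlt_div_r; lra.
  - replace ((Rc ^ 2 + d ^ 2) / Rc ^ 2) with (1 + d ^ 2 / Rc ^ 2) by (field; lra).
    exact H.
Qed.

Lemma poisson_ex_diff (d mu0 G rho0 Rc r mu : R) (U : R -> R -> R) :
  poisson d mu0 G rho0 Rc U -> chart d Rc r mu -> mu <> mu0 ->
  locally_2d (ex_diff_n U 2) r mu.
Proof.
  intros HP HC Hm.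
  assert (N : locally_2d (fun _ v => v <> mu0) r mu).
  { generalize (continuity_2d_pt_neq_0 (fun _ v => v - mu0) r mu); intros N.
    assert (N' : locally_2d (fun _ v => v - mu0 <> 0) r mu).
    { apply N; [|lra]; apply (continuity_2d_pt_snd (fun v => v - mu0)).
      apply ex_derive_continuity_pt; auto_derive; auto. }
    revert N'; apply locally_2d_impl, locally_2d_forall; intros; lra. }
  generalize (locally_2d_and _ _ _ _ (chart_locally _ _ _ _ HC) N).
  apply locally_2d_impl, locally_2d_forall; intros x y [A B].
  apply (HP x y 0 A B).
Qed.

(** At a fixed point, [lapD] times the Poisson equation becomes T (e) = 0 for small e = (d/Rc)^2 >
    0, with coefficients polynomial in e and power series in place of the derivatives of U. The
    relation is T' (0) = 0; its density term comes from the derivative - r^2 of [lapD] in e. *)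
Lemma first_order_relation (d mu0 G rho0 R0 r mu : R)
  (u : nat -> nat -> R -> R) (M : nat -> nat) (U : R -> R -> R -> R) :
  0 < d -> 0 < R0 ->
  power_series_potential d mu0 G u M U ->
  (forall Rc, R0 < Rc -> poisson d mu0 G rho0 Rc (U Rc)) ->
  0 < r -> 0 < mu -> mu <> mu0 -> r ^ 2 < d ^ 2 * (1 + mu ^ 2) ->
  let D0 := d ^ 2 * (1 + mu ^ 2) ^ 2 - r ^ 2 in
  let c (j k n : nat) := 2 * PI * G * d ^ 2 * partial_derive j k (Ucoef d (u n) (M n)) r mu in
  D0 * c 2%nat 0%nat 1%nat - (r ^ 2 + D0 * r ^ 2 / d ^ 2) * c 2%nat 0%nat 0%nat
  + 2 * r * mu * (1 + mu ^ 2) * (c 1%nat 1%nat 1%nat - mu ^ 2 * c 1%nat 1%nat 0%nat)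
  + (1 + mu ^ 2) ^ 2 * (c 0%nat 2%nat 1%nat - mu ^ 2 * c 0%nat 2%nat 0%nat)
  + D0 / r * c 1%nat 0%nat 1%nat - (r + 3 * r * D0 / d ^ 2) * c 1%nat 0%nat 0%nat
  + (1 + mu ^ 2) * mu * (2 * c 0%nat 1%nat 1%nat - (1 + 3 * mu ^ 2) * c 0%nat 1%nat 0%nat)
  + 4 * PI * G * density rho0 mu0 mu * r ^ 2 = 0.
Proof.
  intros Hd HR0 HS HP Hr Hm Hmu HD D0 c.
  destruct (HS r mu Hr Hm HD) as [R1 H1].
  assert (HS' : forall Rc j k, R1 < Rc -> (j + k <= 2)%nat ->
    is_pseries (c j k) ((d / Rc) ^ 2) (partial_derive j k (U Rc) r mu))
    by (intros; apply H1; auto).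
  set (Rm := Rmax (Rmax R0 R1) (d * mu)).
  assert (HRm : R0 <= Rm /\ R1 <= Rm /\ d * mu <= Rm).
  { unfold Rm; pose proof (Rmax_l (Rmax R0 R1) (d * mu));
    pose proof (Rmax_r (Rmax R0 R1) (d * mu));
    pose proof (Rmax_l R0 R1); pose proof (Rmax_r R0 R1); lra. }
  (* The first bound makes Rc large enough for the series, the Poisson equation and d mu < Rc; the
     second one keeps the point in the chart. *)
  set (del := Rmin ((d / Rm) ^ 2) ((d ^ 2 * (1 + mu ^ 2) - r ^ 2) / r ^ 2)).
  assert (Hr2 : 0 < r ^ 2) by (apply pow_lt; auto).
  assert (Hdel : 0 < del).
  { apply Rmin_glb_lt; [apply pow_lt|]; apply Rdiv_lt_0_compat; lra. }
  assert (HPd : forall j k, (j + k <= 2)%nat ->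
    is_derive (PSeries (c j k)) 0 (c j k 1%nat)).
  { intros j k Hjk; eapply is_derive_PSeries_0; [|apply (HS' (Rm + 1)); auto; lra].
    apply pow_nonzero, Rgt_not_eq, Rdiv_lt_0_compat; lra. }
  set (T := fun e =>
    (d ^ 2 * (1 + mu ^ 2) ^ 2 - (1 + e) * r ^ 2) * (1 - e * (r ^ 2 / d ^ 2))
      * PSeries (c 2%nat 0%nat) e
    + 2 * r * mu * (1 - e * mu ^ 2) * (1 + mu ^ 2) * PSeries (c 1%nat 1%nat) e
    + (1 + mu ^ 2) ^ 2 * (1 - e * mu ^ 2) * PSeries (c 0%nat 2%nat) e
    + (d ^ 2 * (1 + mu ^ 2) ^ 2 - (1 + e) * r ^ 2) * (/ r - 3 * e * (r / d ^ 2))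
      * PSeries (c 1%nat 0%nat) e
    + (1 + mu ^ 2) * mu * (2 - e * (1 + 3 * mu ^ 2)) * PSeries (c 0%nat 1%nat) e
    - 4 * PI * G * density rho0 mu0 mu
      * (d ^ 2 * (1 + mu ^ 2) ^ 2 - (1 + e) * r ^ 2)).
  assert (HT : forall e, 0 < e < del -> T e = 0).
  { intros e He.
    assert (He1 : e < (d / Rm) ^ 2)
      by (eapply Rlt_le_trans; [apply He|apply Rmin_l]).
    assert (He2 : e < (d ^ 2 * (1 + mu ^ 2) - r ^ 2) / r ^ 2)
      by (eapply Rlt_le_trans; [apply He|apply Rmin_r]).
    destruct (radius_of_ratio d Rm e Hd) as (B1 & B2 & B3); try lra.
    set (Rc := d / sqrt e) in *.
    assert (HC : chart d Rc r mu).
    { apply chart_of_ratio; try lra; rewrite B3.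
      apply Rlt_div_r in He2; lra. }
    pose proof (poisson_ex_diff _ _ _ _ _ _ _ _ (HP Rc ltac:(lra)) HC Hmu) as L.
    pose proof (laplace_beltrami_chart d Rc r mu 0 (U Rc) Hd ltac:(lra) HC L) as E.
    destruct (HP Rc ltac:(lra) r mu 0 HC Hmu) as [_ E'].
    rewrite E' in E; clear E'.
    assert (V : forall j k, (j + k <= 2)%nat ->
      PSeries (c j k) e = partial_derive j k (U Rc) r mu).
    { intros j k Hjk; rewrite <- B2; apply is_pseries_unique, HS'; auto; lra. }
    unfold T; rewrite !V by lia.
    unfold lapD in E.
    replace ((Rc ^ 2 + d ^ 2) / Rc ^ 2) with (1 + e) in E by (rewrite <- B3; field; lra).
    replace (r ^ 2 / Rc ^ 2) with (e * (r ^ 2 / d ^ 2)) in E by (rewrite <- B3; field; lra).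
    replace (3 * r / Rc ^ 2) with (3 * e * (r / d ^ 2)) in E by (rewrite <- B3; field; lra).
    rewrite B3 in E.
    apply Rminus_diag_eq in E; rewrite <- Ropp_0, <- E; ring. }
  eapply (derive_zero_right T _ del Hdel HT).
  pose proof (HPd 2%nat 0%nat ltac:(lia)) as Q20.
  pose proof (HPd 1%nat 1%nat ltac:(lia)) as Q11.
  pose proof (HPd 0%nat 2%nat ltac:(lia)) as Q02.
  pose proof (HPd 1%nat 0%nat ltac:(lia)) as Q10.
  pose proof (HPd 0%nat 1%nat ltac:(lia)) as Q01.
  pose proof (PSeries_0 (c 2%nat 0%nat)) as Z20.
  pose proof (PSeries_0 (c 1%nat 1%nat)) as Z11.
  pose proof (PSeries_0 (c 0%nat 2%nat)) as Z02.
  pose proof (PSeries_0 (c 1%nat 0%nat)) as Z10.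
  pose proof (PSeries_0 (c 0%nat 1%nat)) as Z01.
  unfold T; clear T HT HPd HS' H1 HS HP.
  (* The five series are turned into abstract functions of which only value and derivative at 0 are
     known, so that [auto_derive] does not look into them. *)
  revert Q20 Q11 Q02 Q10 Q01 Z20 Z11 Z02 Z10 Z01.
  generalize (PSeries (c 2%nat 0%nat)), (PSeries (c 1%nat 1%nat)),
    (PSeries (c 0%nat 2%nat)), (PSeries (c 1%nat 0%nat)), (PSeries (c 0%nat 1%nat)).
  intros f20 f11 f02 f10 f01 Q20 Q11 Q02 Q10 Q01 Z20 Z11 Z02 Z10 Z01.
  auto_derive.
  - split; [eexists; exact Q20|]; split; [eexists; exact Q11|].
    split; [eexists; exact Q02|]; split; [eexists; exact Q10|].
    split; [eexists; exact Q01|exact I].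
  - replace (Derive (fun x => f20 x) 0) with (c 2%nat 0%nat 1%nat)
      by (symmetry; apply is_derive_unique, Q20).
    replace (Derive (fun x => f11 x) 0) with (c 1%nat 1%nat 1%nat)
      by (symmetry; apply is_derive_unique, Q11).
    replace (Derive (fun x => f02 x) 0) with (c 0%nat 2%nat 1%nat)
      by (symmetry; apply is_derive_unique, Q02).
    replace (Derive (fun x => f10 x) 0) with (c 1%nat 0%nat 1%nat)
      by (symmetry; apply is_derive_unique, Q10).
    replace (Derive (fun x => f01 x) 0) with (c 0%nat 1%nat 1%nat)
      by (symmetry; apply is_derive_unique, Q01).
    rewrite Z20, Z11, Z02, Z10, Z01; unfold D0; field; lra.
Qed.

Lemma coef_smooth2 (d mu0 rho0 mu : R) (u : nat -> nat -> R -> R) (M : nat -> nat)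
  (n m : nat) :
  coefficients d mu0 rho0 u M -> (m <= M n)%nat -> 0 < mu -> mu <> mu0 ->
  smooth2 (u n m) mu.
Proof.
  intros HC Hmn Hm Hmu; unfold smooth2.
  assert (L1 : locally mu (fun t => 0 < t)) by (apply open_gt; auto).
  assert (L2 : locally mu (fun t => t <> mu0)) by (apply open_neq; auto).
  generalize (filter_and _ _ L1 L2); apply filter_imp; intros t [A B] j Hj.
  apply (coef_smooth _ _ _ _ _ HC); auto.
Qed.

(** In t = r^2 this is a quadratic that vanishes at Y / 4, Y / 2 and 3 Y / 4; its second difference
    is C Y^2 / 8. *)
Lemma even_quartic_lead_coef (A B C : R) (Y : R) : 0 < Y ->
  (forall r, 0 < r -> r ^ 2 < Y -> A + B * r ^ 2 + C * r ^ 4 = 0) -> C = 0.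
Proof.
  intros HY H.
  assert (E : forall t, 0 < t < Y -> A + B * t + C * t ^ 2 = 0).
  { intros t Ht.
    assert (S2 : sqrt t ^ 2 = t) by (apply pow2_sqrt; lra).
    rewrite <- (H (sqrt t)); [|apply sqrt_lt_R0; lra|lra].
    replace (sqrt t ^ 4) with ((sqrt t ^ 2) ^ 2) by ring; rewrite S2; ring. }
  pose proof (E (Y / 4) ltac:(lra)); pose proof (E (Y / 2) ltac:(lra)).
  pose proof (E (3 * Y / 4) ltac:(lra)).
  assert (0 < Y ^ 2) by (apply pow_lt; auto).
  apply (Rmult_eq_reg_r (Y ^ 2)); lra.
Qed.

(* The r^4-coefficient of the relation of first order in (d/Rc)^2; in it only
   U_1 is differentiated. *)
Lemma wcoef_ode (d mu0 G rho0 R0 mu : R)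
  (u : nat -> nat -> R -> R) (M : nat -> nat) (U : R -> R -> R -> R) :
  0 < d -> 0 < G -> 0 < R0 -> coefficients d mu0 rho0 u M ->
  power_series_potential d mu0 G u M U ->
  (forall Rc, R0 < Rc -> poisson d mu0 G rho0 Rc (U Rc)) ->
  0 < mu -> mu <> mu0 ->
  (1 + mu ^ 2) ^ 2 * Derive_n (wcoef (u 1%nat) 2) 2 mu
  + 10 * mu * (1 + mu ^ 2) * Derive (wcoef (u 1%nat) 2) mu
  - 16 * wcoef (u 1%nat) 2 mu + 8 * wcoef (u 0%nat) 1 mu = 0.
Proof.
  intros Hd HG HR0 HC HS HP Hm Hmu.
  set (a m k := Derive_n (wcoef (u 0%nat) m) k mu).
  set (b m k := Derive_n (wcoef (u 1%nat) m) k mu).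
  change ((1 + mu ^ 2) ^ 2 * b 2%nat 2%nat + 10 * mu * (1 + mu ^ 2) * b 2%nat 1%nat
          - 16 * b 2%nat 0%nat + 8 * a 1%nat 0%nat = 0).
  pose proof PI_RGT_0 as HPI.
  assert (Pa : forall r j k, (k <= 2)%nat ->
    partial_derive j k (Ucoef d (u 0%nat) (M 0%nat)) r mu
    = Derive_n (fun t => sum_f_R0 (fun m => (t / d) ^ (2 * m) * a m k) 1) j r).
  { intros r j k Hk; rewrite (coef_deg0 _ _ _ _ _ HC); apply Ucoef_partial; auto.
    intros m H1; eapply coef_smooth2; eauto; rewrite (coef_deg0 _ _ _ _ _ HC); auto. }
  assert (Pb : forall r j k, (k <= 2)%nat ->
    partial_derive j k (Ucoef d (u 1%nat) (M 1%nat)) r mu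
    = Derive_n (fun t => sum_f_R0 (fun m => (t / d) ^ (2 * m) * b m k) 2) j r).
  { intros r j k Hk; rewrite (coef_deg1 _ _ _ _ _ HC); apply Ucoef_partial; auto.
    intros m H1; eapply coef_smooth2; eauto; rewrite (coef_deg1 _ _ _ _ _ HC); auto. }
  set (s1 := 1 + mu ^ 2).
  assert (Hs1 : 0 < s1) by (unfold s1; nra).
  assert (Hd2 : 0 < d ^ 2) by (apply pow_lt; auto).
  apply (Rmult_eq_reg_r (/ d ^ 4));
    [rewrite Rmult_0_l|apply Rinv_neq_0_compat, pow_nonzero; lra].
  (* The two explicit arguments are the coefficients of r^0 and r^2. The functions u_(1,0), u_(1,1)
     and the density occur only in these. *)
  apply (even_quartic_lead_coef
    (4 * s1 ^ 2 * b 1%nat 0%nat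
     + s1 ^ 2 * (b 0%nat 2%nat - mu ^ 2 * a 0%nat 2%nat)
     + s1 * mu * (2 * b 0%nat 1%nat - (1 + 3 * mu ^ 2) * a 0%nat 1%nat))
    ((16 * s1 ^ 2 * b 2%nat 0%nat - 4 * b 1%nat 0%nat
      + 4 * mu * s1 * (b 1%nat 1%nat - mu ^ 2 * a 1%nat 1%nat)
      + s1 ^ 2 * (b 1%nat 2%nat - mu ^ 2 * a 1%nat 2%nat)
      + s1 * mu * (2 * b 1%nat 1%nat - (1 + 3 * mu ^ 2) * a 1%nat 1%nat)
      - 4 * a 1%nat 0%nat - 8 * s1 ^ 2 * a 1%nat 0%nat
      + 2 * density rho0 mu0 mu) / d ^ 2)
    _ (d ^ 2 * s1) ltac:(nra)).
  intros r Hr HD.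
  pose proof (first_order_relation d mu0 G rho0 R0 r mu u M U Hd HR0 HS HP Hr Hm Hmu HD)
    as E; cbv beta zeta in E.
  rewrite !Pa, !Pb in E by lia.
  destruct (Derive_n_quadratic d r (fun m => a m 0%nat)) as [qa1 qa2]; [lra|].
  destruct (Derive_n_quadratic d r (fun m => a m 1%nat)) as [qa3 _]; [lra|].
  destruct (Derive_n_quartic d r (fun m => b m 0%nat)) as [qb1 qb2]; [lra|].
  destruct (Derive_n_quartic d r (fun m => b m 1%nat)) as [qb3 _]; [lra|].
  cbv beta in *.
  rewrite qa1, qa2, qa3, qb1, qb2, qb3 in E.
  simpl Derive_n in E; simpl sum_f_R0 in E.
  fold s1 in E.
  apply (Rmult_eq_reg_l (2 * PI * G * d ^ 2));
    [|apply Rgt_not_eq, Rmult_lt_0_compat; auto;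
      apply Rmult_lt_0_compat; auto; lra].
  rewrite Rmult_0_r, <- E; unfold s1; field; lra.
Qed.

(** Removing the weight 1 / (4 (1 + mu^2)^2) turns the relation for [wcoef] into a Legendre equation
    at imaginary argument, with 20 = 4 * 5 for degree 4. *)
Lemma quartic_coefficient_ode (d mu0 G rho0 R0 mu : R)
  (u : nat -> nat -> R -> R) (M : nat -> nat) (U : R -> R -> R -> R) :
  0 < d -> 0 < G -> 0 < R0 -> coefficients d mu0 rho0 u M ->
  power_series_potential d mu0 G u M U ->
  (forall Rc, R0 < Rc -> poisson d mu0 G rho0 Rc (U Rc)) ->
  0 < mu -> mu <> mu0 ->
  (1 + mu ^ 2) * Derive_n (u 1%nat 2%nat) 2 mu + 2 * mu * Derive (u 1%nat 2%nat) mu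
  - 20 * u 1%nat 2%nat mu = - 16 * u01 rho0 mu0 mu.
Proof.
  intros Hd HG HR0 HC HS HP Hm Hmu.
  pose proof (wcoef_ode d mu0 G rho0 R0 mu u M U Hd HG HR0 HC HS HP Hm Hmu) as E.
  assert (Hsm : smooth2 (u 1%nat 2%nat) mu)
    by (eapply coef_smooth2; eauto; rewrite (coef_deg1 _ _ _ _ _ HC); auto).
  destruct (smooth2_mult _ _ _ Hsm (smooth2_weight 2 mu)) as (_ & E1 & E2).
  change (fun t => u 1%nat 2%nat t * weight 2 t) with (wcoef (u 1%nat) 2) in E1, E2.
  destruct (smooth2_of_derives (weight 2) (fun y => - y / (1 + y ^ 2) ^ 3)
    (fun y => (5 * y ^ 2 - 1) / (1 + y ^ 2) ^ 4) mu) as (_ & W1 & W2).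
  - apply filter_forall; intros y; unfold weight; auto_derive; [nra|field; nra].
  - apply filter_forall; intros y; auto_derive; [nra|field; nra].
  - rewrite E1, E2, W1, W2 in E; unfold wcoef, weight in E.
    rewrite (coef_u01 _ _ _ _ _ HC mu) in E by lra.
    apply Rminus_diag_uniq.
    apply (Rmult_eq_reg_l (/ (4 * (1 + mu ^ 2))));
      [|apply Rinv_neq_0_compat; nra].
    rewrite Rmult_0_r, <- E; field; nra.
Qed.

(** * Legendre functions of degree 4 at imaginary argument *)

Lemma arccot_bounds (x : R) : 0 < x -> 0 < arccot x <= / x.
Proof.
  intros Hx; unfold arccot; split.
  - pose proof (atan_bound x); lra.
  - rewrite <- atan_inv by auto.
    assert (Hi : 0 < / x) by (apply Rinv_0_lt_compat; auto).
    destruct (MVT_gen atan 0 (/ x) (fun y => / (1 + y ^ 2))) as (c & _ & E).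
    + intros y _; auto_derive; auto; field; nra.
    + intros y _; apply ex_derive_continuity_pt; auto_derive; auto.
    + rewrite atan_0, !Rminus_0_r in E; rewrite E.
      rewrite <- (Rmult_1_l (/ x)) at 2; apply Rmult_le_compat_r; [lra|].
      rewrite <- Rinv_1; apply Rinv_le_contravar; nra.
Qed.

(* P_4 (i y) and, up to a constant factor, Q_4 (i y) for the Legendre functions
   P_4, Q_4: a basis of the solutions of ((1 + y^2) h')' = 20 h. *)
Definition leg4 (y : R) : R := (35 * y ^ 4 + 30 * y ^ 2 + 3) / 8.
Definition dleg4 (y : R) : R := (35 * y ^ 3 + 15 * y) / 2.
Definition legQ4 (y : R) : R :=
  leg4 y * arccot y - (35 / 8 * y ^ 3 + 55 / 24 * y).
Definition dlegQ4 (y : R) : R :=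
  dleg4 y * arccot y - leg4 y / (1 + y ^ 2) - (105 / 8 * y ^ 2 + 55 / 24).

Lemma leg4_pos (y : R) : 0 < leg4 y.
Proof. unfold leg4; assert (0 <= y ^ 2 /\ 0 <= y ^ 4) by (split; nra); lra. Qed.

Lemma is_derive_leg4 (y : R) : is_derive leg4 y (dleg4 y).
Proof. unfold leg4, dleg4; auto_derive; auto; field. Qed.

Lemma is_derive_dleg4 (y : R) : is_derive dleg4 y ((105 * y ^ 2 + 15) / 2).
Proof. unfold dleg4; auto_derive; auto; field. Qed.

Lemma is_derive_legQ4 (y : R) : is_derive legQ4 y (dlegQ4 y).
Proof.
  unfold legQ4, dlegQ4, leg4, dleg4, arccot; auto_derive; auto; field; nra.
Qed.

Lemma leg4_wronskian (y : R) :
  (1 + y ^ 2) * (dleg4 y * legQ4 y - leg4 y * dlegQ4 y) = 1.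
Proof. unfold legQ4, dlegQ4, leg4, dleg4; field; nra. Qed.

Lemma eq_of_derive_0 (I : R -> Prop) (f : R -> R) (x y : R) :
  (forall a b z, I a -> I b -> a <= z <= b -> I z) ->
  (forall z, I z -> is_derive f z 0) -> I x -> I y -> f x = f y.
Proof.
  intros HI Hf Hx Hy.
  destruct (Rtotal_order x y) as [H|[->|H]]; auto.
  - apply (eq_is_derive f x y); auto; intros; apply Hf; eauto.
  - symmetry; apply (eq_is_derive f y x); auto; intros; apply Hf; eauto.
Qed.

(** Reduction of order, possible on any interval since [leg4] has no real zero. The weighted
    Wronskian W of h and [leg4] is a constant K; as the one of [legQ4] and [leg4] is normalised by
    [leg4_wronskian], the quotient V = (h + K legQ4) / leg4 is constant too. *)
Lemma leg4_ode_solutions (I : R -> Prop) (h dh ddh : R -> R) (x0 : R) :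
  (forall a b z, I a -> I b -> a <= z <= b -> I z) -> I x0 ->
  (forall y, I y -> is_derive h y (dh y)) ->
  (forall y, I y -> is_derive dh y (ddh y)) ->
  (forall y, I y -> (1 + y ^ 2) * ddh y + 2 * y * dh y = 20 * h y) ->
  exists c K, forall y, I y ->
    h y = c * leg4 y - K * legQ4 y /\ dh y = c * dleg4 y - K * dlegQ4 y.
Proof.
  intros HI Hx0 H1 H2 HO.
  assert (DP : forall y, is_derive leg4 y (dleg4 y)) by apply is_derive_leg4.
  assert (DQ : forall y, is_derive legQ4 y (dlegQ4 y)) by apply is_derive_legQ4.
  assert (DP2 : forall y, is_derive dleg4 y ((105 * y ^ 2 + 15) / 2))
    by apply is_derive_dleg4.
  set (W y := (1 + y ^ 2) * (dh y * leg4 y - h y * dleg4 y)).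
  assert (HW : forall y, I y -> W y = W x0).
  { intros y Hy; apply (eq_of_derive_0 I); auto; clear y Hy; intros y Hy.
    specialize (H1 y Hy); specialize (H2 y Hy); specialize (HO y Hy).
    replace 0 with (2 * y * (dh y * leg4 y - h y * dleg4 y) +
      (1 + y ^ 2) * ((ddh y * leg4 y + dh y * dleg4 y)
        - (dh y * dleg4 y + h y * ((105 * y ^ 2 + 15) / 2)))).
    - apply (is_derive_mult (fun y => 1 + y ^ 2)
        (fun y => dh y * leg4 y - h y * dleg4 y)).
      + auto_derive; auto; ring.
      + apply (is_derive_minus (fun y => dh y * leg4 y) (fun y => h y * dleg4 y)).
        * apply (is_derive_mult dh leg4); auto using Rmult_comm.
        * apply (is_derive_mult h dleg4); auto using Rmult_comm.
      + apply Rmult_comm.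
    - replace ((1 + y ^ 2) * _) with
        ((1 + y ^ 2) * ddh y * leg4 y - (1 + y ^ 2) * h y * ((105 * y ^ 2 + 15) / 2))
        by ring.
      replace ((1 + y ^ 2) * ddh y) with (20 * h y - 2 * y * dh y) by lra.
      unfold leg4, dleg4; field. }
  set (K := W x0) in *.
  set (V y := (h y + K * legQ4 y) / leg4 y).
  assert (HV : forall y, I y -> V y = V x0).
  { intros y Hy; apply (eq_of_derive_0 I); auto; clear y Hy; intros y Hy.
    specialize (H1 y Hy); specialize (HW y Hy); unfold W in HW.
    replace 0 with (((dh y + K * dlegQ4 y) * leg4 y - (h y + K * legQ4 y) * dleg4 y)
      / leg4 y ^ 2).
    - apply (is_derive_div (fun y => h y + K * legQ4 y) leg4).
      + apply (is_derive_plus h (fun y => K * legQ4 y)); auto.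
        apply (is_derive_scal legQ4); auto.
      + auto.
      + apply Rgt_not_eq, leg4_pos.
    - replace (_ - _) with 0; [unfold Rdiv; ring|].
      apply (Rmult_eq_reg_l (1 + y ^ 2)); [|nra].
      pose proof (leg4_wronskian y) as Wr.
      transitivity ((1 + y ^ 2) * (dh y * leg4 y - h y * dleg4 y)
        - K * ((1 + y ^ 2) * (dleg4 y * legQ4 y - leg4 y * dlegQ4 y))); [|ring].
      rewrite HW, Wr; ring. }
  exists (V x0), K; intros y Hy.
  specialize (HV y Hy); specialize (HW y Hy).
  pose proof (leg4_pos y) as HP; pose proof (leg4_wronskian y) as Wr.
  assert (E : h y = V x0 * leg4 y - K * legQ4 y).
  { rewrite <- HV; unfold V; field; lra. }
  split; auto.
  apply (Rmult_eq_reg_l ((1 + y ^ 2) * leg4 y)); [|apply Rgt_not_eq; nra].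
  transitivity (W y + (1 + y ^ 2) * h y * dleg4 y); [unfold W; ring|].
  rewrite HW, E.
  transitivity (K * ((1 + y ^ 2) * (dleg4 y * legQ4 y - leg4 y * dlegQ4 y))
    + (1 + y ^ 2) * (V x0 * leg4 y - K * legQ4 y) * dleg4 y); [rewrite Wr|]; ring.
Qed.

(* Where w = 35 mu^4 + 10 mu^2 - 1 > 0, the right-hand side divided by w tends
   to 0 at infinity and has derivative - 128 mu^2 / ((1 + mu^2) w)^2. *)
Lemma arccot_quartic_bound (mu : R) : 0 < mu ->
  0 < (1 - 10 * mu ^ 2 - 35 * mu ^ 4) * arccot mu
      + mu * (35 * mu ^ 4 + 100 / 3 * mu ^ 2 + 1) / (1 + mu ^ 2).
Proof.
  intros Hm.
  set (w y := 35 * y ^ 4 + 10 * y ^ 2 - 1).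
  set (N y := y * (35 * y ^ 4 + 100 / 3 * y ^ 2 + 1)).
  assert (HN : forall y, 0 < y -> 0 < N y).
  { intros y Hy; apply Rmult_lt_0_compat; auto.
    assert (0 < y ^ 2 /\ 0 < y ^ 4) by (split; apply pow_lt; auto); lra. }
  replace (1 - 10 * mu ^ 2 - 35 * mu ^ 4) with (- w mu) by (unfold w; ring).
  fold (N mu).
  pose proof (arccot_bounds mu Hm) as [Hk _].
  assert (HNm : 0 < N mu / (1 + mu ^ 2)) by (apply Rdiv_lt_0_compat; [auto|nra]).
  (* For w <= 0 the first summand is nonnegative and the second one positive; the rest treats w >
     0. *)
  destruct (Rle_lt_dec (w mu) 0) as [Hw|Hw]; [nra|].
  set (J y := N y / ((1 + y ^ 2) * w y) - arccot y).
  assert (Hwy : forall y, mu <= y -> 0 < w y).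
  { intros y Hy; eapply Rlt_le_trans; [exact Hw|].
    assert (mu ^ 2 <= y ^ 2) by (apply pow_incr; lra).
    assert (mu ^ 4 <= y ^ 4) by (apply pow_incr; lra).
    unfold w; lra. }
  assert (HJ : forall x y, mu <= x -> x < y -> J y < J x).
  { intros x y Hx Hxy.
    destruct (MVT_gen J x y
      (fun y => - 128 * y ^ 2 / ((1 + y ^ 2) * w y) ^ 2)) as (c & Hc & E).
    - rewrite Rmin_left, Rmax_right by lra; intros z Hz.
      assert (HH := Hwy z ltac:(lra)).
      unfold J, N, w, arccot in *; auto_derive.
      + apply Rgt_not_eq, Rmult_lt_0_compat; nra.
      + field; split; [lra|nra].
    - rewrite Rmin_left, Rmax_right by lra; intros z Hz.
      assert (HH := Hwy z ltac:(lra)).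
      apply ex_derive_continuity_pt.
      unfold J, N, w, arccot in *; auto_derive.
      apply Rgt_not_eq, Rmult_lt_0_compat; nra.
    - rewrite Rmin_left, Rmax_right in Hc by lra.
      assert (HH := Hwy c ltac:(lra)).
      assert (0 < 128 * c ^ 2 / ((1 + c ^ 2) * w c) ^ 2).
      { apply Rdiv_lt_0_compat; [nra|apply pow_lt, Rmult_lt_0_compat; nra]. }
      replace (- 128 * c ^ 2 / ((1 + c ^ 2) * w c) ^ 2)
        with (- (128 * c ^ 2 / ((1 + c ^ 2) * w c) ^ 2)) in E
        by (unfold Rdiv; ring).
      nra. }
  (* J decreases and satisfies J z >= - 1 / z, so a negative value at mu + 1 is contradicted at a
     large z. The shift by 1 makes the inequality strict at mu. *)
  assert (HJ1 : 0 <= J (mu + 1)).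
  { destruct (Rle_lt_dec 0 (J (mu + 1))) as [|Neg]; auto; exfalso.
    set (z := Rmax (mu + 2) (- / J (mu + 1))).
    assert (Hz : mu + 2 <= z) by apply Rmax_l.
    assert (Hz2 : - / J (mu + 1) <= z) by apply Rmax_r.
    assert (A : J z < J (mu + 1)) by (apply HJ; lra).
    assert (B : - / z <= J z).
    { unfold J; pose proof (arccot_bounds z ltac:(lra)).
      assert (0 < N z / ((1 + z ^ 2) * w z)).
      { apply Rdiv_lt_0_compat; [apply HN; lra|].
        apply Rmult_lt_0_compat; [nra|apply Hwy; lra]. }
      lra. }
    assert (C : / z <= - J (mu + 1)).
    { rewrite <- (Rinv_inv (- J (mu + 1))).
      apply Rinv_le_contravar.
      - apply Rinv_0_lt_compat; lra.
      - rewrite Rinv_opp; exact Hz2. }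
    lra. }
  assert (A : 0 < J mu) by (eapply Rle_lt_trans; [exact HJ1|apply HJ; lra]).
  replace (_ + _) with (w mu * J mu); [nra|].
  unfold J; field; split; [nra|lra].
Qed.

(** * The r^4-coefficient on the boundary *)

(** On the great sphere mu = Rc / d = y, U_1 is an even quartic in r. The combination U (Rc) - 4 U
    (Rc / 2) + 3 U (0) annihilates 1 and r^2 and keeps 1 - 4 / 16 = 3 / 4 of the r^4-term, which
    isolates u_(1,2). It is at most 1 + 4 + 3 = 8 times the bound on U_1, and (1 + y^2)^2 / y^4 <= 4
    for y >= 1. *)
Lemma quartic_coefficient_growth (d mu0 rho0 : R) (u : nat -> nat -> R -> R)
  (M : nat -> nat) :
  0 < d -> coefficients d mu0 rho0 u M ->
  exists K Y, forall y, Y <= y -> Rabs (u 1%nat 2%nat y) <= K * y ^ 2.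
Proof.
  intros Hd HC; destruct (coef_growth _ _ _ _ _ HC) as (C & R1 & H).
  exists (16 * (32 / 3 * C * d ^ 2)), (Rmax 1 (R1 / d)); intros y Hy.
  assert (Y1 : 1 <= y) by (eapply Rle_trans; [apply Rmax_l|exact Hy]).
  assert (Y2 : R1 <= d * y).
  { assert (A : R1 / d <= y) by (eapply Rle_trans; [apply Rmax_r|exact Hy]).
    apply Rle_div_l in A; lra. }
  assert (Hdy : 0 < d * y) by (apply Rmult_lt_0_compat; lra).
  pose proof (H (d * y) 0 Y2 ltac:(lra)) as H0.
  pose proof (H (d * y) (d * y / 2) Y2 ltac:(lra)) as H2.
  pose proof (H (d * y) (d * y) Y2 ltac:(lra)) as H1.
  replace (d * y / d) with y in H0, H1, H2 by (field; lra).
  set (U r := Ucoef d (u 1%nat) 2 r y) in *.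
  change (Ucoef d (u 1%nat) 2 0 y) with (U 0) in H0.
  change (Ucoef d (u 1%nat) 2 (d * y / 2) y) with (U (d * y / 2)) in H2.
  change (Ucoef d (u 1%nat) 2 (d * y) y) with (U (d * y)) in H1.
  assert (E : u 1%nat 2%nat y = 16 / 3 * ((1 + y ^ 2) ^ 2 / y ^ 4)
    * (U (d * y) - 4 * U (d * y / 2) + 3 * U 0)).
  { unfold U, Ucoef; simpl; field; repeat split; nra. }
  assert (Q : 0 <= (1 + y ^ 2) ^ 2 / y ^ 4 <= 4).
  { assert (0 < y ^ 4) by (apply pow_lt; lra).
    split; [apply Rdiv_le_0_compat; nra|].
    apply Rle_div_l; auto; assert (1 <= y ^ 2) by nra; nra. }
  assert (T : Rabs (U (d * y) - 4 * U (d * y / 2) + 3 * U 0) <= 8 * (C * (d * y) ^ 2)).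
  { apply Rabs_le_between in H0; apply Rabs_le_between in H1;
    apply Rabs_le_between in H2; apply Rabs_le_between; lra. }
  rewrite E, Rabs_mult, Rabs_pos_eq by lra.
  apply Rle_trans with (16 / 3 * 4 * (8 * (C * (d * y) ^ 2))).
  - apply Rmult_le_compat; try lra; apply Rabs_pos.
  - apply Req_le; field.
Qed.

(** The two branches of [u01], each continued across mu0, so that two-sided derivatives at mu0 are
    available for the matching. *)
Definition u01_in (rho0 mu0 y : R) : R :=
  rho0 * (mu0 * (1 + 3 * y ^ 2) * ((1 + mu0 ^ 2) * arccot mu0 - mu0) - 2 * y ^ 2).
Definition du01_in (rho0 mu0 y : R) : R :=
  rho0 * (6 * mu0 * ((1 + mu0 ^ 2) * arccot mu0 - mu0) - 4) * y.
Definition u01_out (rho0 mu0 y : R) : R :=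
  rho0 * mu0 * (1 + mu0 ^ 2) * ((1 + 3 * y ^ 2) * arccot y - 3 * y).
Definition du01_out (rho0 mu0 y : R) : R :=
  rho0 * mu0 * (1 + mu0 ^ 2)
  * (6 * y * arccot y - (1 + 3 * y ^ 2) / (1 + y ^ 2) - 3).

Lemma is_derive_u01_in (rho0 mu0 y : R) :
  is_derive (u01_in rho0 mu0) y (du01_in rho0 mu0 y).
Proof. unfold u01_in, du01_in; auto_derive; auto; ring. Qed.

Lemma is_derive_u01_out (rho0 mu0 y : R) :
  is_derive (u01_out rho0 mu0) y (du01_out rho0 mu0 y).
Proof. unfold u01_out, du01_out, arccot; auto_derive; auto; field; nra. Qed.

(** Consequently the common part 8/7 u_(0,1) of the two solutions cancels in the matching at mu0,
    and the constant - 8/35 rho0 alone determines c and K. *)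
Lemma u01_C1 (rho0 mu0 : R) :
  u01_in rho0 mu0 mu0 = u01_out rho0 mu0 mu0 /\
  du01_in rho0 mu0 mu0 = du01_out rho0 mu0 mu0.
Proof.
  unfold u01_in, u01_out, du01_in, du01_out; split; [ring|field; nra].
Qed.

(** * One-sided limits and growth at infinity *)

Lemma continuity_pt_agree_right (f g : R -> R) (x b : R) : x < b ->
  continuity_pt f x -> continuity_pt g x ->
  (forall y, x < y < b -> f y = g y) -> f x = g x.
Proof.
  intros Hb Hf Hg H.
  destruct (Req_dec (f x) (g x)) as [|N]; auto; exfalso.
  assert (HC : continuity_pt (fun y => f y - g y) x) by (apply continuity_pt_minus; auto).
  destruct (HC (Rabs (f x - g x))) as (a & Ha & Hc); [apply Rabs_pos_lt; lra|].
  set (y := x + Rmin a (b - x) / 2).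
  assert (x < y < b /\ y - x < a)
    by (unfold y; pose proof (Rmin_l a (b - x)); pose proof (Rmin_r a (b - x));
        assert (0 < Rmin a (b - x)) by (apply Rmin_glb_lt; lra); lra).
  specialize (Hc y); simpl in Hc; unfold R_dist in Hc.
  rewrite (H y) in Hc by lra.
  replace (g y - g y - (f x - g x)) with (- (f x - g x)) in Hc by ring.
  rewrite Rabs_Ropp in Hc; apply (Rlt_irrefl (Rabs (f x - g x))), Hc; split.
  - split; [exact I|lra].
  - rewrite Rabs_pos_eq; lra.
Qed.

Lemma continuity_pt_agree_left (f g : R -> R) (x a : R) : a < x ->
  continuity_pt f x -> continuity_pt g x ->
  (forall y, a < y < x -> f y = g y) -> f x = g x.
Proof.
  intros Ha Hf Hg H.
  assert (N : forall h, continuity_pt h x -> continuity_pt (fun y => h (- y)) (- x)).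
  { intros h Hh; apply (continuity_pt_comp Ropp h).
    - apply ex_derive_continuity_pt; auto_derive; auto.
    - rewrite Ropp_involutive; auto. }
  pose proof (continuity_pt_agree_right (fun y => f (- y)) (fun y => g (- y))
    (- x) (- a) ltac:(lra) (N f Hf) (N g Hg)) as E.
  cbv beta in E; rewrite Ropp_involutive in E.
  apply E; intros y Hy; apply H; lra.
Qed.

(** v equals g only to the right of 0, and v 0 could be any number. A finite limit of the difference
    quotient forces v 0 = g 0, after which the limit is the derivative of g. *)
Lemma right_derivative_agree (v g : R -> R) (b l : R) : 0 < b ->
  (forall y, 0 < y < b -> v y = g y) -> is_derive g 0 l ->
  filterlim (fun h => (v h - v 0) / h) (at_right 0) (locally 0) -> l = 0.
Proof.
  intros Hb Hvg Hg Hv.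
  assert (Q : forall eps, 0 < eps -> exists del, 0 < del /\ del <= b /\
    forall h, 0 < h < del -> Rabs ((g h - v 0) / h) < eps).
  { intros eps He.
    assert (L : locally 0 (ball (0 : R) (mkposreal eps He))) by apply locally_ball.
    destruct (Hv _ L) as (del & Hdel).
    exists (Rmin del b); split; [apply Rmin_glb_lt; auto; apply del|].
    split; [apply Rmin_r|]; intros h Hh.
    pose proof (Rmin_l del b); pose proof (Rmin_r del b).
    specialize (Hdel h); unfold ball in Hdel; simpl in Hdel;
      unfold AbsRing_ball, abs, minus, plus, opp in Hdel; simpl in Hdel.
    rewrite Ropp_0, !Rplus_0_r in Hdel.
    rewrite <- Hvg by lra; apply Hdel; [rewrite Rabs_pos_eq; lra|lra]. }
  assert (V0 : v 0 = g 0).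
  { destruct (Q 1 ltac:(lra)) as (del & D1 & D2 & D3).
    assert (HC : continuity_pt g 0) by (apply ex_derive_continuity_pt; eexists; exact Hg).
    destruct (Req_dec (v 0) (g 0)) as [|N]; auto; exfalso.
    set (e := Rabs (v 0 - g 0) / 2).
    assert (He : 0 < e).
    { unfold e; assert (0 < Rabs (v 0 - g 0)) by (apply Rabs_pos_lt; lra); lra. }
    destruct (HC e He) as (a & Ha & Hc).
    set (h := Rmin (Rmin a del) e / 2).
    assert (Hh : 0 < h < del /\ h < a /\ h < e).
    { unfold h; pose proof (Rmin_l (Rmin a del) e); pose proof (Rmin_r (Rmin a del) e);
      pose proof (Rmin_l a del); pose proof (Rmin_r a del).
      assert (0 < Rmin (Rmin a del) e) by (repeat apply Rmin_glb_lt; lra); lra. }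
    specialize (D3 h ltac:(lra)).
    specialize (Hc h); simpl in Hc; unfold R_dist in Hc.
    assert (A : Rabs (g h - g 0) < e).
    { apply Hc; split; [split; [exact I|lra]|rewrite Rabs_pos_eq; lra]. }
    assert (B : Rabs (g h - v 0) < e).
    { replace (g h - v 0) with ((g h - v 0) / h * h) by (field; lra).
      rewrite Rabs_mult, (Rabs_pos_eq h) by lra; nra. }
    assert (T : Rabs (v 0 - g 0) <= Rabs (g h - g 0) + Rabs (g h - v 0)).
    { replace (v 0 - g 0) with ((g h - g 0) - (g h - v 0)) by ring.
      eapply Rle_trans; [apply Rabs_triang|]; rewrite Rabs_Ropp; lra. }
    unfold e in A, B; lra. }
  destruct (Req_dec l 0) as [|N]; auto; exfalso.
  assert (He : 0 < Rabs l / 2) by (assert (0 < Rabs l) by (apply Rabs_pos_lt; auto); lra).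
  destruct (Q _ He) as (del & D1 & D2 & D3).
  apply is_derive_Reals in Hg; destruct (Hg _ He) as (a & Hc).
  set (h := Rmin a del / 2).
  assert (Hh : 0 < h < del /\ h < a).
  { unfold h; pose proof (Rmin_l a del); pose proof (Rmin_r a del).
    assert (0 < Rmin a del) by (apply Rmin_glb_lt; [apply a|lra]); lra. }
  specialize (D3 h ltac:(lra)); rewrite V0 in D3.
  specialize (Hc h ltac:(lra)); rewrite Rplus_0_l, (Rabs_pos_eq h) in Hc by lra.
  specialize (Hc ltac:(lra)).
  assert (T : Rabs l <= Rabs ((g h - g 0) / h) + Rabs ((g h - g 0) / h - l)).
  { replace l with ((g h - g 0) / h - ((g h - g 0) / h - l)) at 1 by ring.
    eapply Rle_trans; [apply Rabs_triang|]; rewrite Rabs_Ropp; lra. }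
  lra.
Qed.

(** Q_4 (i y) decays like y^(-5), but smallness relative to [leg4] is all that is needed to exclude
    [leg4] outside the body. *)
Lemma legQ4_small (y : R) : 1 <= y -> Rabs (legQ4 y) <= 3 * leg4 y / y.
Proof.
  intros Hy; pose proof (arccot_bounds y ltac:(lra)) as [K1 K2].
  pose proof (leg4_pos y) as HP.
  assert (A : 0 <= leg4 y * arccot y <= leg4 y / y).
  { split; [apply Rmult_le_pos; lra|apply Rmult_le_compat_l; lra]. }
  assert (B : 35 / 8 * y ^ 3 + 55 / 24 * y <= 2 * leg4 y / y).
  { apply Rle_div_r; [lra|]; unfold leg4; nra. }
  assert (C : 0 <= 35 / 8 * y ^ 3 + 55 / 24 * y)
    by (assert (0 < y ^ 3) by (apply pow_lt; lra); lra).
  assert (0 < leg4 y / y) by (apply Rdiv_lt_0_compat; lra).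
  replace (3 * leg4 y / y) with (3 * (leg4 y / y)) by (unfold Rdiv; ring).
  replace (2 * leg4 y / y) with (2 * (leg4 y / y)) in B by (unfold Rdiv; ring).
  unfold legQ4; apply Rabs_le_between; lra.
Qed.

Lemma zero_of_bound_inv (c K Y : R) :
  (forall y, Y <= y -> Rabs c * y <= K) -> c = 0.
Proof.
  intros H; destruct (Req_dec c 0) as [|N]; auto; exfalso.
  assert (Hc : 0 < Rabs c) by (apply Rabs_pos_lt; auto).
  specialize (H (Rmax Y ((K + 1) / Rabs c)) (Rmax_l _ _)).
  assert (A : Rabs c * ((K + 1) / Rabs c) <= Rabs c * Rmax Y ((K + 1) / Rabs c))
    by (apply Rmult_le_compat_l; [lra|apply Rmax_r]).
  replace (Rabs c * ((K + 1) / Rabs c)) with (K + 1) in A by (field; lra).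
  lra.
Qed.

(** The inner branch f of u_(0,1) satisfies ((1 + y^2) f')' = 6 f - 4 rho0. Hence the factor 8/7 =
    16 / (20 - 6); the constant - 8/35 rho0 compensates the remaining - 32/7 rho0. *)
Lemma quartic_coefficient_inside (rho0 mu0 : R) (v : R -> R) :
  0 < mu0 ->
  (forall y, 0 < y -> y <> mu0 -> smooth2 v y) ->
  (forall y, 0 < y -> y < mu0 ->
    (1 + y ^ 2) * Derive_n v 2 y + 2 * y * Derive v y - 20 * v y
    = - 16 * u01_in rho0 mu0 y) ->
  filterlim (fun h => (v h - v 0) / h) (at_right 0) (locally 0) ->
  exists c, forall y, 0 < y < mu0 ->
    v y = 8 / 7 * u01_in rho0 mu0 y - 8 / 35 * rho0 + c * leg4 y /\
    Derive v y = 8 / 7 * du01_in rho0 mu0 y + c * dleg4 y.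
Proof.
  intros Hm Hs HO H0.
  destruct (leg4_ode_solutions (fun y => 0 < y < mu0)
    (fun y => v y - (8 / 7 * u01_in rho0 mu0 y - 8 / 35 * rho0))
    (fun y => Derive v y - 8 / 7 * du01_in rho0 mu0 y)
    (fun y => Derive_n v 2 y
      - 8 / 7 * (rho0 * (6 * mu0 * ((1 + mu0 ^ 2) * arccot mu0 - mu0) - 4)))
    (mu0 / 2)) as (c & K & HcK).
  - intros a b z Ha Hb Hz; lra.
  - lra.
  - intros y Hy; destruct (smooth2_derive v y) as [D1 _]; [apply Hs; lra|].
    apply (is_derive_minus v); auto.
    replace (8 / 7 * du01_in rho0 mu0 y) with (8 / 7 * du01_in rho0 mu0 y - 0) by ring.
    apply (is_derive_minus (fun y => 8 / 7 * u01_in rho0 mu0 y) (fun _ => 8 / 35 * rho0)).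
    + apply (is_derive_scal (u01_in rho0 mu0)), is_derive_u01_in.
    + apply (is_derive_const (V := R_NormedModule)).
  - intros y Hy; destruct (smooth2_derive v y) as [_ D2]; [apply Hs; lra|].
    apply (is_derive_minus (Derive v)); auto.
    apply (is_derive_scal (du01_in rho0 mu0)).
    unfold du01_in; auto_derive; auto; ring.
  - intros y Hy; specialize (HO y ltac:(lra) ltac:(lra)).
    replace ((1 + y ^ 2) * _) with
      ((1 + y ^ 2) * Derive_n v 2 y - (1 + y ^ 2)
       * (8 / 7 * (rho0 * (6 * mu0 * ((1 + mu0 ^ 2) * arccot mu0 - mu0) - 4)))) by ring.
    replace ((1 + y ^ 2) * Derive_n v 2 y)
      with (20 * v y - 16 * u01_in rho0 mu0 y - 2 * y * Derive v y) by lra.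
    unfold u01_in, du01_in; field.
  - (* legQ4' (0) = - 8 / 3, so that the condition at 0 excludes legQ4. *)
    assert (HK : K = 0).
    { apply (Rmult_eq_reg_r (8 / 3)); [|lra]; rewrite Rmult_0_l.
      apply (right_derivative_agree v (fun y =>
        8 / 7 * u01_in rho0 mu0 y - 8 / 35 * rho0 + (c * leg4 y - K * legQ4 y)) mu0); auto.
      - intros y Hy; destruct (HcK y Hy) as [E _]; lra.
      - pose proof (is_derive_u01_in rho0 mu0 0) as A1.
        pose proof (is_derive_leg4 0) as A2; pose proof (is_derive_legQ4 0) as A3.
        auto_derive; [repeat split; eexists; eassumption|].
        replace (Derive (fun x => u01_in rho0 mu0 x) 0) with (du01_in rho0 mu0 0)
          by (symmetry; apply is_derive_unique, A1).
        replace (Derive (fun x => leg4 x) 0) with (dleg4 0)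
          by (symmetry; apply is_derive_unique, A2).
        replace (Derive (fun x => legQ4 x) 0) with (dlegQ4 0)
          by (symmetry; apply is_derive_unique, A3).
        unfold du01_in, dlegQ4, dleg4, leg4; field. }
    exists c; intros y Hy; destruct (HcK y Hy) as [E1 E2]; rewrite HK in E1, E2; lra.
Qed.

(** The outer branch f of u_(0,1) satisfies ((1 + y^2) f')' = 6 f, without a source, so 8/7 f is a
    particular solution. A bound of order y^2 does not admit [leg4], which grows like y^4. *)
Lemma quartic_coefficient_outside (rho0 mu0 B Y : R) (v : R -> R) :
  0 < mu0 ->
  (forall y, 0 < y -> y <> mu0 -> smooth2 v y) ->
  (forall y, mu0 < y ->
    (1 + y ^ 2) * Derive_n v 2 y + 2 * y * Derive v y - 20 * v y
    = - 16 * u01_out rho0 mu0 y) ->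
  (forall y, Y <= y -> Rabs (v y) <= B * y ^ 2) ->
  exists K, forall y, mu0 < y ->
    v y = 8 / 7 * u01_out rho0 mu0 y - K * legQ4 y /\
    Derive v y = 8 / 7 * du01_out rho0 mu0 y - K * dlegQ4 y.
Proof.
  intros Hm Hs HO HB.
  set (q := rho0 * mu0 * (1 + mu0 ^ 2)).
  destruct (leg4_ode_solutions (fun y => mu0 < y)
    (fun y => v y - 8 / 7 * u01_out rho0 mu0 y)
    (fun y => Derive v y - 8 / 7 * du01_out rho0 mu0 y)
    (fun y => Derive_n v 2 y
      - 8 / 7 * (q * (6 * arccot y - 6 * y / (1 + y ^ 2) - 4 * y / (1 + y ^ 2) ^ 2)))
    (mu0 + 1)) as (c & K & HcK).
  - intros a b z Ha Hb Hz; lra.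
  - lra.
  - intros y Hy; destruct (smooth2_derive v y) as [D1 _]; [apply Hs; lra|].
    apply (is_derive_minus v); auto.
    apply (is_derive_scal (u01_out rho0 mu0)), is_derive_u01_out.
  - intros y Hy; destruct (smooth2_derive v y) as [_ D2]; [apply Hs; lra|].
    apply (is_derive_minus (Derive v)); auto.
    apply (is_derive_scal (du01_out rho0 mu0)).
    unfold du01_out, arccot; fold q; auto_derive; [nra|field; nra].
  - intros y Hy; specialize (HO y Hy).
    replace ((1 + y ^ 2) * _) with
      ((1 + y ^ 2) * Derive_n v 2 y - (1 + y ^ 2) *
      (8 / 7 * (q * (6 * arccot y - 6 * y / (1 + y ^ 2) - 4 * y / (1 + y ^ 2) ^ 2))))
      by ring.
    replace ((1 + y ^ 2) * Derive_n v 2 y)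
      with (20 * v y - 16 * u01_out rho0 mu0 y - 2 * y * Derive v y) by lra.
    unfold u01_out, du01_out; fold q; field; nra.
  (* All terms other than c [leg4] are bounded by multiples of y^2 and of [leg4 y / y]. Since y^2 <=
     leg4 y / y, division by [leg4 y / y] bounds [Rabs c * y]. *)
  - assert (Hc : c = 0).
    { apply (zero_of_bound_inv c (Rabs B + 8 * Rabs q + 3 * Rabs K) (Rmax (mu0 + 1) (Rmax 1 Y))).
      intros y Hy.
      pose proof (Rmax_l (mu0 + 1) (Rmax 1 Y)); pose proof (Rmax_r (mu0 + 1) (Rmax 1 Y)).
      pose proof (Rmax_l 1 Y); pose proof (Rmax_r 1 Y).
      assert (Y1 : 1 <= y) by lra.
      destruct (HcK y ltac:(lra)) as [E _].
      specialize (HB y ltac:(lra)).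
      pose proof (legQ4_small y Y1) as HQ.
      assert (Hl : y ^ 3 <= leg4 y) by (unfold leg4; assert (0 <= y ^ 2) by nra; nra).
      assert (Hy2 : 1 <= y ^ 2) by nra.
      assert (Hu : Rabs (u01_out rho0 mu0 y) <= Rabs q * (7 * y ^ 2)).
      { unfold u01_out; fold q; rewrite Rabs_mult.
        apply Rmult_le_compat_l; [apply Rabs_pos|].
        pose proof (arccot_bounds y ltac:(lra)) as [K1 K2].
        assert (/ y <= 1) by (rewrite <- Rinv_1; apply Rinv_le_contravar; lra).
        assert (0 <= (1 + 3 * y ^ 2) * arccot y <= 1 + 3 * y ^ 2) by (split; nra).
        apply Rabs_le_between; nra. }
      assert (HKQ : Rabs (K * legQ4 y) <= Rabs K * (3 * leg4 y / y)).
      { rewrite Rabs_mult; apply Rmult_le_compat_l; auto; apply Rabs_pos. }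
      assert (HB2 : B * y ^ 2 <= Rabs B * y ^ 2)
        by (apply Rmult_le_compat_r; [lra|apply Rle_abs]).
      assert (T : Rabs (c * leg4 y)
        <= (Rabs B + 8 * Rabs q) * y ^ 2 + 3 * Rabs K * (leg4 y / y)).
      { replace (c * leg4 y) with (v y - 8 / 7 * u01_out rho0 mu0 y + K * legQ4 y)
          by (rewrite E; ring).
        replace (Rabs K * (3 * leg4 y / y)) with (3 * Rabs K * (leg4 y / y)) in HKQ
          by (field; lra).
        apply Rabs_le_between in HB; apply Rabs_le_between in Hu;
        apply Rabs_le_between in HKQ; apply Rabs_le_between; lra. }
      pose proof (leg4_pos y) as HP.
      rewrite Rabs_mult, (Rabs_pos_eq (leg4 y)) in T by lra.
      assert (A : y ^ 2 <= leg4 y / y).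
      { apply -> Rle_div_r; [|lra].
        replace (y ^ 2 * y) with (y ^ 3) by ring; exact Hl. }
      assert (0 <= Rabs B + 8 * Rabs q) by (pose proof (Rabs_pos B); pose proof (Rabs_pos q); lra).
      apply (Rmult_le_reg_r (leg4 y / y)); [apply Rdiv_lt_0_compat; lra|].
      replace (Rabs c * y * (leg4 y / y)) with (Rabs c * leg4 y) by (field; lra).
      nra. }
    exists K; intros y Hy; destruct (HcK y Hy) as [E1 E2]; rewrite Hc in E1, E2; lra.
Qed.

(** Continuity of u_(1,2) and of its derivative at mu0 gives two linear equations for c and K,
    solved by the Wronskian. Inserting K, one finds that the boundary value is rho0 mu0 (1 +
    mu0^2)^2 / 2 times the expression in [arccot_quartic_bound]. *)
Lemma quartic_coefficient_boundary_pos (d mu0 rho0 : R)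
  (u : nat -> nat -> R -> R) (M : nat -> nat) :
  0 < d -> 0 < mu0 -> 0 < rho0 -> coefficients d mu0 rho0 u M ->
  (forall y, 0 < y -> y <> mu0 ->
    (1 + y ^ 2) * Derive_n (u 1%nat 2%nat) 2 y + 2 * y * Derive (u 1%nat 2%nat) y
    - 20 * u 1%nat 2%nat y = - 16 * u01 rho0 mu0 y) ->
  0 < u 1%nat 2%nat mu0.
Proof.
  intros Hd Hm Hrho HC HO.
  set (v := u 1%nat 2%nat) in *.
  assert (Hs : forall y, 0 < y -> y <> mu0 -> smooth2 v y).
  { intros y H1 H2; eapply coef_smooth2; eauto; rewrite (coef_deg1 _ _ _ _ _ HC); auto. }
  destruct (quartic_coefficient_inside rho0 mu0 v Hm Hs) as (c & Hin).
  { intros y H1 H2; rewrite HO by lra; unfold u01, u01_in.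
    destruct (Rle_dec y mu0); [reflexivity|lra]. }
  { apply (coef_at0 _ _ _ _ _ HC 2%nat); auto. }
  destruct (quartic_coefficient_growth _ _ _ _ _ Hd HC) as (B & Y & HB).
  destruct (quartic_coefficient_outside rho0 mu0 B Y v Hm Hs) as (K & Hout); auto.
  { intros y H1; rewrite HO by lra; unfold u01, u01_out.
    destruct (Rle_dec y mu0); [lra|reflexivity]. }
  destruct (coef_C1 _ _ _ _ _ HC 2%nat (le_n _)) as [C0 C1]; fold v in C0, C1.
  apply ex_derive_continuity_pt in C0.
  apply continuity_pt_filterlim in C1.
  assert (Dsm : forall f g : R -> R, (forall y, is_derive f y (g y)) ->
    continuity_pt f mu0)
    by (intros f g H; apply ex_derive_continuity_pt; eexists; apply H).
  pose proof (Dsm _ _ (is_derive_u01_in rho0 mu0)) as cf.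
  pose proof (Dsm _ _ (is_derive_u01_out rho0 mu0)) as cg.
  pose proof (Dsm _ _ is_derive_leg4) as cP.
  pose proof (Dsm _ _ is_derive_dleg4) as cdP.
  pose proof (Dsm _ _ is_derive_legQ4) as cQ.
  assert (cdf : continuity_pt (du01_in rho0 mu0) mu0)
    by (apply ex_derive_continuity_pt; unfold du01_in; auto_derive; auto).
  assert (cdg : continuity_pt (du01_out rho0 mu0) mu0)
    by (apply ex_derive_continuity_pt; unfold du01_out, arccot; auto_derive; nra).
  assert (cdQ : continuity_pt dlegQ4 mu0)
    by (apply ex_derive_continuity_pt; unfold dlegQ4, dleg4, leg4, arccot; auto_derive; nra).
  assert (cc : forall a, continuity_pt (fun _ => a) mu0)
    by (intros; apply continuity_pt_const; intros ? ?; reflexivity).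
  assert (E1 : v mu0 = 8 / 7 * u01_in rho0 mu0 mu0 - 8 / 35 * rho0 + c * leg4 mu0).
  { apply (continuity_pt_agree_left v (fun y =>
      8 / 7 * u01_in rho0 mu0 y - 8 / 35 * rho0 + c * leg4 y) mu0 0); auto.
    - apply (continuity_pt_plus (fun y => 8 / 7 * u01_in rho0 mu0 y - 8 / 35 * rho0)
        (fun y => c * leg4 y)).
      + apply (continuity_pt_minus (fun y => 8 / 7 * u01_in rho0 mu0 y)); auto.
        apply (continuity_pt_scal (u01_in rho0 mu0)); auto.
      + apply (continuity_pt_scal leg4); auto.
    - intros y Hy; apply Hin; lra. }
  assert (E2 : Derive v mu0 = 8 / 7 * du01_in rho0 mu0 mu0 + c * dleg4 mu0).
  { apply (continuity_pt_agree_left (Derive v) (fun y =>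
      8 / 7 * du01_in rho0 mu0 y + c * dleg4 y) mu0 0); auto.
    - apply (continuity_pt_plus (fun y => 8 / 7 * du01_in rho0 mu0 y)
        (fun y => c * dleg4 y)).
      + apply (continuity_pt_scal (du01_in rho0 mu0)); auto.
      + apply (continuity_pt_scal dleg4); auto.
    - intros y Hy; apply Hin; lra. }
  assert (E3 : v mu0 = 8 / 7 * u01_out rho0 mu0 mu0 - K * legQ4 mu0).
  { apply (continuity_pt_agree_right v (fun y =>
      8 / 7 * u01_out rho0 mu0 y - K * legQ4 y) mu0 (mu0 + 1)); auto; [lra| |].
    - apply (continuity_pt_minus (fun y => 8 / 7 * u01_out rho0 mu0 y)
        (fun y => K * legQ4 y)).
      + apply (continuity_pt_scal (u01_out rho0 mu0)); auto.
      + apply (continuity_pt_scal legQ4); auto.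
    - intros y Hy; apply Hout; lra. }
  assert (E4 : Derive v mu0 = 8 / 7 * du01_out rho0 mu0 mu0 - K * dlegQ4 mu0).
  { apply (continuity_pt_agree_right (Derive v) (fun y =>
      8 / 7 * du01_out rho0 mu0 y - K * dlegQ4 y) mu0 (mu0 + 1)); auto; [lra| |].
    - apply (continuity_pt_minus (fun y => 8 / 7 * du01_out rho0 mu0 y)
        (fun y => K * dlegQ4 y)).
      + apply (continuity_pt_scal (du01_out rho0 mu0)); auto.
      + apply (continuity_pt_scal dlegQ4); auto.
    - intros y Hy; apply Hout; lra. }
  destruct (u01_C1 rho0 mu0) as [F1 F2]; rewrite F1 in E1; rewrite F2 in E2.
  pose proof (leg4_wronskian mu0) as W.
  assert (A1 : - (8 / 35) * rho0 + c * leg4 mu0 = - K * legQ4 mu0) by lra.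
  assert (A2 : c * dleg4 mu0 = - K * dlegQ4 mu0) by lra.
  assert (HK : K = 8 / 35 * rho0 * (1 + mu0 ^ 2) * dleg4 mu0).
  { transitivity (K * ((1 + mu0 ^ 2) * (dleg4 mu0 * legQ4 mu0 - leg4 mu0 * dlegQ4 mu0)));
      [rewrite W; ring|].
    transitivity ((1 + mu0 ^ 2) * (- (- K * legQ4 mu0) * dleg4 mu0
      + leg4 mu0 * (- K * dlegQ4 mu0))); [ring|].
    rewrite <- A1, <- A2; ring. }
  rewrite E3, HK.
  pose proof (arccot_quartic_bound mu0 Hm) as HA.
  set (H := (1 - 10 * mu0 ^ 2 - 35 * mu0 ^ 4) * arccot mu0
      + mu0 * (35 * mu0 ^ 4 + 100 / 3 * mu0 ^ 2 + 1) / (1 + mu0 ^ 2)) in *.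
  replace (_ - _) with (rho0 * mu0 * (1 + mu0 ^ 2) ^ 2 / 2 * H).
  - apply Rmult_lt_0_compat; auto.
    apply Rdiv_lt_0_compat; [|lra].
    apply Rmult_lt_0_compat; [apply Rmult_lt_0_compat; auto|apply pow_lt; nra].
  - unfold H, u01_out, legQ4, dleg4, leg4; field; nra.
Qed.

(** * Steady flow *)

Lemma derive_nonzero_right (T : R -> R) (l : R) :
  T 0 = 0 -> l <> 0 -> is_derive T 0 l ->
  exists del, 0 < del /\ forall x, 0 < x < del -> T x <> 0.
Proof.
  intros T0 Hl HD; apply is_derive_Reals in HD.
  destruct (HD (Rabs l) (Rabs_pos_lt _ Hl)) as (del & H).
  exists del; split; [apply del|]; intros x Hx E.
  specialize (H x ltac:(lra)); rewrite Rplus_0_l, E, T0, (Rabs_pos_eq x) in H by lra.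
  specialize (H ltac:(lra)).
  replace ((0 - 0) / x - l) with (- l) in H by (field; lra).
  rewrite Rabs_Ropp in H; lra.
Qed.

(** Composition with [clamp] extends a function continuous on a closed segment to the whole line, so
    that theorems about two-sided continuity apply at its end points. *)
Definition clamp (lo hi x : R) : R := Rmax lo (Rmin x hi).

Lemma clamp_range (lo hi x : R) : lo <= hi -> lo <= clamp lo hi x <= hi.
Proof.
  intros H; unfold clamp; split; [apply Rmax_l|].
  apply Rmax_lub; auto; apply Rmin_r.
Qed.

Lemma clamp_id (lo hi x : R) : lo <= x <= hi -> clamp lo hi x = x.
Proof.
  intros H; unfold clamp; rewrite Rmin_left, Rmax_right; lra.
Qed.

Lemma clamp_lipschitz (lo hi x y : R) :
  Rabs (clamp lo hi x - clamp lo hi y) <= Rabs (x - y).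
Proof.
  unfold clamp, Rmax, Rmin.
  repeat destruct (Rle_dec _ _); unfold Rabs;
    repeat destruct (Rcase_abs _); lra.
Qed.

(** For fixed r the body contains, with m0, the whole segment from m0 to mu0, because the constraint
    on r weakens as mu grows. *)
Lemma body_slice_continuity (d mu0 Rc r m0 : R) (f : R -> R -> R) :
  continuous_on_body d mu0 Rc f -> body d mu0 Rc r m0 ->
  continuity (fun m => f r (clamp m0 mu0 m)).
Proof.
  intros Hf (B1 & B2 & B3) m.
  assert (HB : forall x, body d mu0 Rc r (clamp m0 mu0 x)).
  { intros x; pose proof (clamp_range m0 mu0 x ltac:(lra)) as C.
    split; [auto|split; [lra|]]; eapply Rle_trans; [exact B3|].
    apply Rmult_le_compat_l; [apply pow2_ge_0|].
    assert (m0 ^ 2 <= clamp m0 mu0 x ^ 2) by (apply pow_incr; lra); lra. }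
  intros eps He.
  assert (L := Hf (r, clamp m0 mu0 m) (HB m) _
    (locally_ball (f r (clamp m0 mu0 m) : R) (mkposreal eps He))).
  destruct L as (del & Hdel).
  exists del; split; [apply del|]; intros x [_ Hx].
  apply (Hdel (r, clamp m0 mu0 x)); [|apply HB].
  split; [apply ball_center|].
  eapply Rle_lt_trans; [apply clamp_lipschitz|exact Hx].
Qed.

(** The Euler equations determine omega^2 only. A change of sign would produce a zero of the
    continuous f, and then its constant square would be 0 everywhere. *)
Lemma eq_of_constant_square (f : R -> R) (a b : R) : a < b -> continuity f ->
  (forall x y, a < x < b -> a < y < b -> f x ^ 2 = f y ^ 2) -> f a = f b.
Proof.
  intros Hab Hf H.
  set (s := f ((a + b) / 2) ^ 2).
  assert (Hf2 : forall x, continuity_pt (fun y => f y ^ 2) x).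
  { intros x; apply (continuity_pt_comp f (fun z => z ^ 2)); auto.
    apply ex_derive_continuity_pt; auto_derive; auto. }
  assert (Hs : forall x, a <= x <= b -> f x ^ 2 = s).
  { intros x Hx.
    assert (Hc : continuity_pt (fun _ => s) x)
      by (apply continuity_pt_const; intros ? ?; reflexivity).
    destruct (Rlt_le_dec x b).
    - apply (continuity_pt_agree_right (fun y => f y ^ 2) (fun _ => s) x b); auto.
      intros y Hy; apply H; lra.
    - apply (continuity_pt_agree_left (fun y => f y ^ 2) (fun _ => s) x a); auto; [lra|].
      intros y Hy; apply H; lra. }
  destruct (Req_dec (f a) (f b)) as [|N]; auto; exfalso.
  pose proof (Hs a ltac:(lra)) as Ha; pose proof (Hs b ltac:(lra)) as Hb.
  assert (E : (f a - f b) * (f a + f b) = 0) by lra.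
  apply Rmult_integral in E.
  assert (E' : f a = - f b) by lra; clear E.
  destruct (IVT_gen f a b 0) as (x & Hx & Ex); auto.
  { rewrite E'; unfold Rmin, Rmax; destruct (Rle_dec _ _); lra. }
  rewrite Rmin_left, Rmax_right in Hx by lra.
  pose proof (Hs x Hx) as E; rewrite Ex in E.
  assert (f b = 0) by nra; lra.
Qed.

Lemma body_interior_chart (d mu0 Rc r mu m : R) :
  0 < d -> d * mu0 < Rc -> body d mu0 Rc r mu -> mu < m < mu0 -> chart d Rc r m.
Proof.
  intros Hd HR (B1 & B2 & B3) Hm; split; [auto|split].
  - split; [lra|]; apply Rlt_div_r; nra.
  - eapply Rle_lt_trans; [exact B3|].
    apply Rmult_lt_compat_l; [apply pow_lt; auto|nra].
Qed.

Lemma chart_raise (d Rc r m m' : R) :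
  0 < d -> chart d Rc r m -> m <= m' -> m' < Rc / d -> chart d Rc r m'.
Proof.
  intros Hd (H1 & H2 & H3) Hm Hm'; split; [auto|split; [lra|]].
  eapply Rlt_le_trans; [exact H3|].
  apply Rmult_le_compat_l; [apply pow2_ge_0|].
  assert (m ^ 2 <= m' ^ 2) by (apply pow_incr; lra); lra.
Qed.

Lemma steady_flow_square (d mu0 G rho0 Rc r m1 m2 : R) (U p omega : R -> R -> R) :
  0 < d -> d * mu0 < Rc ->
  poisson d mu0 G rho0 Rc U -> steady_flow d mu0 rho0 Rc U p omega ->
  chart d Rc r m1 -> m1 < m2 < mu0 ->
  omega r m1 ^ 2 = omega r m2 ^ 2.
Proof.
  intros Hd HR HP HF HC Hm.
  assert (Hmu : mu0 < Rc / d) by (apply Rlt_div_r; nra).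
  set (F t m := U t m + / rho0 * p t m).
  assert (D : forall t m, chart d Rc t m -> m < mu0 ->
    is_derive (fun x => F x m) t (t * omega t m ^ 2) /\
    is_derive (fun y => F t y) m 0).
  { intros t m Ht Hlt.
    destruct (ex_diff_2_partials U t m) as (U1 & U2 & _).
    { eapply poisson_ex_diff; eauto; lra. }
    destruct (flow_diff_p _ _ _ _ _ _ _ HF t m Ht Hlt) as [P1 P2].
    rewrite <- (flow_r _ _ _ _ _ _ _ HF t m Ht Hlt),
      <- (flow_mu _ _ _ _ _ _ _ HF t m Ht Hlt); split.
    - apply (is_derive_plus (fun x => U x m) (fun x => / rho0 * p x m)); auto.
      apply (is_derive_scal (fun x => p x m)), Derive_correct, P1.
    - apply (is_derive_plus (fun y => U t y) (fun y => / rho0 * p t y)); auto.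
      apply (is_derive_scal (fun y => p t y)), Derive_correct, P2. }
  assert (HC2 : chart d Rc r m2) by (apply (chart_raise d Rc r m1); auto; lra).
  destruct (D r m1 HC ltac:(lra)) as [D1 _]; destruct (D r m2 HC2 ltac:(lra)) as [D2 _].
  assert (E : r * omega r m1 ^ 2 = r * omega r m2 ^ 2).
  { rewrite <- (is_derive_unique _ _ _ D1), <- (is_derive_unique _ _ _ D2).
    (* For every t near r the segment from (t, m1) to (t, m2) lies in the chart, so F takes the same
       value at both ends and its two r-derivatives agree. *)
    apply Derive_ext_loc.
    generalize (locally_2d_1d_const_y _ _ _ (chart_locally _ _ _ _ HC)).
    apply filter_imp; intros t Ht.
    apply (eq_is_derive (fun y => F t y)); [|lra].
    intros y Hy; apply D; [|lra]; apply (chart_raise d Rc t m1); auto; lra. }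
  apply (Rmult_eq_reg_l r); auto; apply Rgt_not_eq, HC.
Qed.

(** The point itself may lie on the focal disc or in the equatorial plane, outside the chart. The
    open segment from mu to mu0 does lie in the chart, and continuity covers its ends. *)
Lemma omega_depends_on_r (d mu0 G rho0 Rc r mu : R) (U p omega : R -> R -> R) :
  0 < d -> d * mu0 < Rc ->
  poisson d mu0 G rho0 Rc U -> steady_flow d mu0 rho0 Rc U p omega ->
  body d mu0 Rc r mu -> omega r mu = omega r mu0.
Proof.
  intros Hd HR HP HF HB.
  destruct (Req_dec mu mu0) as [->|N]; auto.
  assert (Hlt : mu < mu0) by (destruct HB as (_ & B & _); lra).
  set (f m := omega r (clamp mu mu0 m)).
  replace (omega r mu) with (f mu) by (unfold f; rewrite clamp_id by lra; auto).
  replace (omega r mu0) with (f mu0) by (unfold f; rewrite clamp_id by lra; auto).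
  apply eq_of_constant_square; auto; unfold f.
  - apply (body_slice_continuity d mu0 Rc r mu omega); auto.
    apply (flow_cont_omega _ _ _ _ _ _ _ HF).
  - intros x y Hx Hy; rewrite !clamp_id by lra.
    destruct (Rtotal_order x y) as [H|[->|H]]; auto.
    + eapply steady_flow_square; eauto; [eapply body_interior_chart; eauto|lra].
    + symmetry; eapply steady_flow_square; eauto; [eapply body_interior_chart; eauto|lra].
Qed.

(** For constant omega, U + p / rho0 - c^2 r^2 / 2 does not depend on r on the levels mu < mu0,
    where the Euler equations hold; the limit mu -> mu0 removes p. The bounds r2 <= 3 d / 4 and 2 d
    <= Rc give r^2 (1 + d^2 / Rc^2) <= 45/64 d^2, so these radii lie in the chart for all mu in
    question. *)
Lemma rigid_boundary_potential (d mu0 G rho0 Rc c r1 r2 : R) (U p omega : R -> R -> R) :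
  0 < d -> 0 < mu0 -> d * mu0 < Rc -> 2 * d <= Rc ->
  poisson d mu0 G rho0 Rc U -> steady_flow d mu0 rho0 Rc U p omega ->
  (forall r mu, body d mu0 Rc r mu -> omega r mu = c) ->
  0 < r1 < r2 -> r2 <= 3 * d / 4 ->
  U r1 mu0 - c ^ 2 * r1 ^ 2 / 2 = U r2 mu0 - c ^ 2 * r2 ^ 2 / 2.
Proof.
  intros Hd Hm HR HR2 HP HF Hc Hr Hr2.
  assert (Hmu : mu0 < Rc / d) by (apply Rlt_div_r; nra).
  assert (HC : forall t m, 0 < t <= r2 -> 0 < m <= mu0 -> chart d Rc t m).
  { intros t m Ht Hm'; apply chart_of_ratio; try lra; [nra|].
    assert (d ^ 2 / Rc ^ 2 <= 1 / 4).
    { apply Rle_div_l; [apply pow_lt; lra|nra]. }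
    assert (t ^ 2 <= (3 * d / 4) ^ 2) by (apply pow_incr; lra).
    assert (0 < d ^ 2) by (apply pow_lt; auto).
    assert (0 <= d ^ 2 * m ^ 2) by (apply Rmult_le_pos; nra).
    assert (0 < t ^ 2) by (apply pow_lt; lra).
    apply Rle_lt_trans with (t ^ 2 * (5 / 4)); [apply Rmult_le_compat_l; lra|].
    lra. }
  assert (HB : forall t m, 0 < t <= r2 -> 0 < m <= mu0 -> body d mu0 Rc t m).
  { intros t m Ht Hm'; destruct (HC t m Ht Hm') as (A1 & A2 & A3).
    split; [auto|split; lra]. }
  set (H t m := U t m + / rho0 * p t m - c ^ 2 * t ^ 2 / 2).
  assert (E : forall m, 0 < m < mu0 -> H r1 m = H r2 m).
  { intros m Hm'; apply (eq_is_derive (fun t => H t m)); [|lra].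
    intros t Ht; assert (HCt := HC t m ltac:(lra) ltac:(lra)).
    destruct (ex_diff_2_partials U t m) as (U1 & _).
    { eapply poisson_ex_diff; eauto; lra. }
    destruct (flow_diff_p _ _ _ _ _ _ _ HF t m HCt ltac:(lra)) as [P1 _].
    pose proof (flow_r _ _ _ _ _ _ _ HF t m HCt ltac:(lra)) as FR.
    rewrite (Hc t m) in FR by (apply HB; lra).
    change zero with 0.
    replace 0 with (partial_derive 1 0 U t m + / rho0 * Derive (fun x => p x m) t
      - t * c ^ 2).
    - apply (is_derive_minus (fun t => U t m + / rho0 * p t m) (fun t => c ^ 2 * t ^ 2 / 2)).
      + apply (is_derive_plus (fun x => U x m) (fun x => / rho0 * p x m)); auto.
        apply (is_derive_scal (fun x => p x m)), Derive_correct, P1.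
      + auto_derive; auto; field.
    - rewrite <- FR; unfold partial_derive; simpl; ring. }
  assert (Hcl : forall t, 0 < t <= r2 ->
    continuity (fun m => H t (clamp (mu0 / 2) mu0 m))).
  { intros t Ht; assert (HBt := HB t (mu0 / 2) Ht ltac:(lra)).
    apply (continuity_minus (fun m => U t (clamp (mu0 / 2) mu0 m)
      + / rho0 * p t (clamp (mu0 / 2) mu0 m)) (fun _ => c ^ 2 * t ^ 2 / 2)).
    - apply (continuity_plus (fun m => U t (clamp (mu0 / 2) mu0 m))
        (fun m => / rho0 * p t (clamp (mu0 / 2) mu0 m))).
      + apply (body_slice_continuity d mu0 Rc t (mu0 / 2) U); auto.
        apply (flow_cont_U _ _ _ _ _ _ _ HF).
      + apply (continuity_scal (fun m => p t (clamp (mu0 / 2) mu0 m))).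
        apply (body_slice_continuity d mu0 Rc t (mu0 / 2) p); auto.
        apply (flow_cont_p _ _ _ _ _ _ _ HF).
    - apply continuity_const; intros ? ?; reflexivity. }
  assert (E0 : H r1 mu0 = H r2 mu0).
  { rewrite <- (clamp_id (mu0 / 2) mu0 mu0) by lra.
    apply (continuity_pt_agree_left (fun m => H r1 (clamp (mu0 / 2) mu0 m))
      (fun m => H r2 (clamp (mu0 / 2) mu0 m)) mu0 (mu0 / 2)); [lra| | |].
    - apply Hcl; lra.
    - apply Hcl; lra.
    - intros m Hm'; rewrite clamp_id by lra; apply E; lra. }
  unfold H in E0.
  rewrite !(flow_free_boundary _ _ _ _ _ _ _ HF) in E0 by (apply HB; lra).
  lra.
Qed.

(* The weights 5, -8, 3 annihilate 1 and r^2 at r = d/4, d/2, 3d/4, so that the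
   r^4-coefficient of U_1 dominates. *)
Lemma potential_not_quadratic (d mu0 G rho0 : R)
  (u : nat -> nat -> R -> R) (M : nat -> nat) (U : R -> R -> R -> R) :
  0 < d -> 0 < mu0 -> 0 < G -> coefficients d mu0 rho0 u M ->
  power_series_potential d mu0 G u M U -> u 1%nat 2%nat mu0 <> 0 ->
  exists R1, forall Rc, R1 < Rc ->
    5 * U Rc (d / 4) mu0 - 8 * U Rc (d / 2) mu0 + 3 * U Rc (3 * d / 4) mu0 <> 0.
Proof.
  intros Hd Hm HG HC HS Hu.
  set (c r n := 2 * PI * G * d ^ 2 * Ucoef d (u n) (M n) r mu0).
  assert (HSr : forall r, 0 < r < d -> exists R1, forall Rc, R1 < Rc ->
    is_pseries (c r) ((d / Rc) ^ 2) (U Rc r mu0)).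
  { intros r Hr; destruct (HS r mu0) as [R1 H]; try lra; [nra|].
    exists R1; intros Rc HRc; apply (H Rc HRc 0%nat 0%nat); auto. }
  destruct (HSr (d / 4)) as [Ra Ha]; [lra|].
  destruct (HSr (d / 2)) as [Rb Hb]; [lra|].
  destruct (HSr (3 * d / 4)) as [Re He]; [lra|].
  assert (D : forall r, (exists R1, forall Rc, R1 < Rc ->
    is_pseries (c r) ((d / Rc) ^ 2) (U Rc r mu0)) ->
    is_derive (PSeries (c r)) 0 (c r 1%nat)).
  { intros r [R1 H]; eapply is_derive_PSeries_0; [|apply (H (Rmax R1 0 + 1))].
    - pose proof (Rmax_r R1 0); apply pow_nonzero, Rgt_not_eq, Rdiv_lt_0_compat; lra.
    - pose proof (Rmax_l R1 0); lra. }
  set (T x := 5 * PSeries (c (d / 4)) x - 8 * PSeries (c (d / 2)) x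
              + 3 * PSeries (c (3 * d / 4)) x).
  destruct (derive_nonzero_right T
    (5 * c (d / 4) 1%nat - 8 * c (d / 2) 1%nat + 3 * c (3 * d / 4) 1%nat))
    as (del & Hdel & HT).
  (* U_0 has no r^4-term, so the combination vanishes in order zero. *)
  - unfold T; rewrite !PSeries_0; unfold c; rewrite (coef_deg0 _ _ _ _ _ HC).
    unfold Ucoef; simpl; field; split; nra.
  - unfold c; rewrite (coef_deg1 _ _ _ _ _ HC).
    (* 5 / 4^4 - 8 / 2^4 + 3 (3/4)^4 = 120 / 256. *)
    replace (_ + _) with (2 * PI * G * d ^ 2 * (120 / 256)
      * (/ (4 * (1 + mu0 ^ 2) ^ 2) * u 1%nat 2%nat mu0))
      by (unfold Ucoef; simpl; field; split; nra).
    pose proof PI_RGT_0.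
    assert (0 < 1 + mu0 ^ 2) by nra.
    assert (0 < 2 * PI * G * d ^ 2).
    { apply Rmult_lt_0_compat; [apply Rmult_lt_0_compat; lra|apply pow_lt; auto]. }
    apply Rmult_integral_contrapositive_currified; [lra|].
    apply Rmult_integral_contrapositive_currified; auto.
    apply Rinv_neq_0_compat, Rgt_not_eq.
    apply Rmult_lt_0_compat; [lra|apply pow_lt; auto].
  - apply (is_derive_plus (fun x => 5 * PSeries (c (d / 4)) x - 8 * PSeries (c (d / 2)) x)
      (fun x => 3 * PSeries (c (3 * d / 4)) x)).
    + apply (is_derive_minus (fun x => 5 * PSeries (c (d / 4)) x)
        (fun x => 8 * PSeries (c (d / 2)) x)).
      * apply (is_derive_scal (PSeries (c (d / 4)))), D; eauto.
      * apply (is_derive_scal (PSeries (c (d / 2)))), D; eauto.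
    + apply (is_derive_scal (PSeries (c (3 * d / 4)))), D; eauto.
  - exists (Rmax (Rmax Ra Rb) (Rmax Re (d / sqrt del))); intros Rc HRc.
    pose proof (Rmax_l (Rmax Ra Rb) (Rmax Re (d / sqrt del))).
    pose proof (Rmax_r (Rmax Ra Rb) (Rmax Re (d / sqrt del))).
    pose proof (Rmax_l Ra Rb); pose proof (Rmax_r Ra Rb).
    pose proof (Rmax_l Re (d / sqrt del)); pose proof (Rmax_r Re (d / sqrt del)).
    assert (Hsq : 0 < sqrt del) by (apply sqrt_lt_R0; auto).
    assert (Hq : 0 < d / sqrt del) by (apply Rdiv_lt_0_compat; auto).
    assert (HRc0 : 0 < Rc) by lra.
    rewrite <- (is_pseries_unique _ _ _ (Ha Rc ltac:(lra))),
      <- (is_pseries_unique _ _ _ (Hb Rc ltac:(lra))),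
      <- (is_pseries_unique _ _ _ (He Rc ltac:(lra))).
    apply HT; split; [apply pow_lt, Rdiv_lt_0_compat; auto|].
    rewrite <- (pow2_sqrt del) by lra.
    assert (d / Rc < sqrt del).
    { apply Rlt_div_l; auto.
      assert (A : d / sqrt del < Rc) by lra.
      apply Rlt_div_l in A; auto; lra. }
    assert (0 < d / Rc) by (apply Rdiv_lt_0_compat; auto).
    nra.
Qed.

Theorem mainTheorem4
  (a b G rho0 R0 d mu0 : R)
  (u : nat -> nat -> R -> R) (M : nat -> nat)
  (U p omega : R -> R -> R -> R)
  (hb : 0 < b) (hab : b < a) (hG : 0 < G) (hrho : 0 < rho0) (hR0 : a <= R0)
  (hd : d = sqrt (a ^ 2 - b ^ 2)) (hmu0 : mu0 = b / sqrt (a ^ 2 - b ^ 2))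
  (hcoef : coefficients d mu0 rho0 u M)
  (hseries : power_series_potential d mu0 G u M U)
  (hpoisson : forall Rc, R0 < Rc -> poisson d mu0 G rho0 Rc (U Rc))
  (hflow : forall Rc, R0 < Rc ->
     steady_flow d mu0 rho0 Rc (U Rc) (p Rc) (omega Rc)) :
  (forall Rc, R0 < Rc ->
     exists Omega : R -> R, forall r mu,
       body d mu0 Rc r mu -> omega Rc r mu = Omega r)
  /\
  (exists R1, R0 <= R1 /\ forall Rc, R1 < Rc ->
     ~ exists c : R, forall r mu, body d mu0 Rc r mu -> omega Rc r mu = c).
Proof.
  assert (Hd : 0 < d) by (rewrite hd; apply sqrt_lt_R0; nra).
  rewrite <- hd in hmu0.
  assert (Hmu0 : 0 < mu0) by (rewrite hmu0; apply Rdiv_lt_0_compat; auto).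
  (* With b < a <= R0 < Rc this gives d mu0 < Rc: the body stays within the range mu < Rc / d of the
     chart. *)
  assert (Hdm : d * mu0 = b) by (rewrite hmu0; field; lra).
  split.
  - intros Rc HRc; exists (fun r => omega Rc r mu0); intros r mu HB.
    apply (omega_depends_on_r d mu0 G rho0 Rc r mu (U Rc) (p Rc)); auto; lra.
  - destruct (potential_not_quadratic d mu0 G rho0 u M U) as [R1 HR1]; auto.
    { apply Rgt_not_eq, (quartic_coefficient_boundary_pos d mu0 rho0 u M); auto.
      intros y H1 H2.
      apply (quartic_coefficient_ode d mu0 G rho0 R0 y u M U); auto; lra. }
    (* The entry 2 d ensures that the three radii d / 4, d / 2 and 3 d / 4 lie in the chart at every
       level 0 < mu <= mu0. *)
    exists (Rmax R0 (Rmax R1 (2 * d))).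
    pose proof (Rmax_l R0 (Rmax R1 (2 * d))); pose proof (Rmax_r R0 (Rmax R1 (2 * d))).
    pose proof (Rmax_l R1 (2 * d)); pose proof (Rmax_r R1 (2 * d)).
    split; auto; intros Rc HRc [c Hc].
    apply (HR1 Rc); [lra|].
    assert (E : forall r1 r2, 0 < r1 < r2 -> r2 <= 3 * d / 4 ->
      U Rc r1 mu0 - c ^ 2 * r1 ^ 2 / 2 = U Rc r2 mu0 - c ^ 2 * r2 ^ 2 / 2).
    { intros r1 r2 Hr Hr2.
      apply (rigid_boundary_potential d mu0 G rho0 Rc c r1 r2 (U Rc) (p Rc) (omega Rc));
        auto; try lra; [apply hpoisson|apply hflow]; lra. }
    pose proof (E (d / 4) (d / 2) ltac:(lra) ltac:(lra)) as E1.
    pose proof (E (d / 2) (3 * d / 4) ltac:(lra) ltac:(lra)) as E2.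
    assert (V1 : U Rc (d / 4) mu0 = U Rc (d / 2) mu0 - c ^ 2 * (d / 2) ^ 2 / 2
      + c ^ 2 * (d / 4) ^ 2 / 2) by lra.
    assert (V2 : U Rc (3 * d / 4) mu0 = U Rc (d / 2) mu0 - c ^ 2 * (d / 2) ^ 2 / 2
      + c ^ 2 * (3 * d / 4) ^ 2 / 2) by lra.
    rewrite V1, V2; field.
Qed.
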